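(* Let $S,B\subseteq([-1,1]\cup\{*\})^X$ be real-valued hypothesis classes. For $\eta_1\ge0$, $\eta_2,\beta\in(0,1/2)$ and $\delta\in(0,1/2)$, letting $m:=\sup_{\theta\in\mathbb{R}}\mathsf{VC}(S^{(0)}_{\eta_1},B^{(\theta)}_{\eta_2})$, \[ \#\mathsf{DCorM}(S,B,\beta+2\eta_1+2\eta_2,\delta)\le O\!\left(\frac m{\beta^2}\log_+^2\!\left(\frac m\beta\right)+\frac1{\beta^2}\log\!\left(\frac1{\eta_2\delta}\right)\right). \] Moreover, for $\varepsilon\in(0,1/2)$, taking $\beta=\eta_1=\eta_2=\varepsilon/5$ in the definition of $m$, one has $m\le\mathsf{fat}_{\varepsilon/5}(S,B)$ and \[ \#\mathsf{DCorM}(S,B,\varepsilon,\delta)\le O\!\left(\frac m{\varepsilon^2}\log_+^2\!\left(\frac m\varepsilon\right)+\frac1{\varepsilon^2}\log\!\left(\frac1{\varepsilon\delta}\right)\right). \]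
   Context: $X$ non-empty; hypotheses $h:X\to[-1,1]\cup\{*\}$; distributions discrete. For $r:X\to\mathbb{R}$, $\eta\ge0$: $h^{(r)}_\eta(x)=1$ if $h(x)\neq*$ and $h(x)>r(x)+\eta$, $=-1$ if $h(x)\ne*$ and $h(x)<r(x)-\eta$, $=*$ otherwise; $H^{(r)}_\eta=\{h^{(r)}_\eta:h\in H\}$, and $H^{(\theta)}_\eta$ uses constant $r\equiv\theta$. $\mathsf{VC}(H_1,H_2)$ for binary classes: sup of $|X'|$ over $X'$ shattered by both (every $\xi:X'\to\{-1,1\}$ agrees on $X'$ with a member). $X'$ is $\eta$-fat shattered by $H$ if for some $r:X'\to\mathbb{R}$, every $\xi:X'\to\{-1,1\}$ has $h\in H$ with $h(x)\ne*$ and $\xi(x)(h(x)-r(x))>\eta$ on $X'$; $\mathsf{fat}_\eta(S,B)$ = sup of $|X'|$ over $X'$ $\eta$-fat shattered by both $S$ and $B$. Generalized product $u_1\diamondsuit u_2=u_1u_2$ if $u_2\in[-1,1]$, $=-|u_1|$ if $u_2=*$. $\mathsf{DCorM}_n(S,B,\varepsilon,\delta)$: learners taking $n$ points of $X\times[-1,1]$, outputting $f:X\to\{-1,1\}$, such that for every distribution $\mu$ with $\Pr_\mu[s(x)=y]=1$ for some $s\in S$, with probability $\ge1-\delta$ over $n$ i.i.d. samples, $\mathbb{E}_\mu[yf(x)]\ge\sup_{b\in B}\mathbb{E}_\mu[y\diamondsuit b(x)]-\varepsilon$. $\#\mathsf{DCorM}$ is the least such $n$. $\log_+(u)=\log_2\max\{2,u\}$.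 *)

(* Defs.v *)
From HB Require Import structures.
From mathcomp Require Import all_boot all_order all_algebra.
From mathcomp Require Import all_classical all_reals all_analysis.
From mathcomp Require Import Rstruct Rstruct_topology.
Set Implicit Arguments. Unset Strict Implicit. Unset Printing Implicit Defensive.
Import Order.TTheory GRing.Theory Num.Theory.
Local Open Scope classical_set_scope.
Local Open Scope ring_scope.

Notation R := Rdefinitions.R.

(* A (partial) real hypothesis on X: None encodes the symbol "*". *)
Definition hyp (X : Type) := X -> option R.

Definition valid_class (X : Type) (H : set (hyp X)) : Prop :=
  forall h, H h -> forall x v, h x = Some v -> -1 <= v <= 1.

Definition sgn (b : bool) : R := if b then 1 else -1.

Definition thr (X : Type) (r : X -> R) (eta : R) (h : hyp X) : hyp X :=
  fun x => match h x with
           | Some v => if r x + eta < v then Some 1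
                       else if v < r x - eta then Some (-1) else None
           | None => None
           end.

Definition thr_class (X : Type) (H : set (hyp X)) (r : X -> R) (eta : R)
  : set (hyp X) := thr r eta @` H.
Definition thr_const (X : Type) (H : set (hyp X)) (theta eta : R) : set (hyp X) :=
  thr_class H (fun _ => theta) eta.

(* The finite set X' = e('I_k) (e injective) is shattered by a binary class H *)
Definition shatters (X : Type) (H : set (hyp X)) (k : nat) (e : 'I_k -> X) : Prop :=
  forall xi : 'I_k -> bool, exists2 g, H g & forall i, g (e i) = Some (sgn (xi i)).

Definition VC2 (X : Type) (H1 H2 : set (hyp X)) : \bar R :=
  ereal_sup [set ((k%:R : R)%:E) | k in
     [set k : nat | exists e : 'I_k -> X, injective e /\ shatters H1 e /\ shatters H2 e]].

Definition fat_shatters (X : Type) (H : set (hyp X)) (eta : R) (k : nat)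
  (e : 'I_k -> X) : Prop :=
  exists r : 'I_k -> R, forall xi : 'I_k -> bool, exists2 h, H h &
    forall i, exists v, h (e i) = Some v /\ sgn (xi i) * (v - r i) > eta.

Definition fat2 (X : Type) (eta : R) (S B : set (hyp X)) : \bar R :=
  ereal_sup [set ((k%:R : R)%:E) | k in
     [set k : nat | exists e : 'I_k -> X, injective e /\
                      fat_shatters S eta e /\ fat_shatters B eta e]].

Definition gprod (u1 : R) (u2 : option R) : R :=
  match u2 with Some v => u1 * v | None => - `|u1| end.

(* A discrete distribution on X x [-1,1], given by its atoms a k with weights
   w k (countable support; atoms may repeat, weights may vanish). *)
Definition distribution (X : Type) (w : nat -> R) (a : nat -> X * R) : Prop :=
  (forall k, 0 <= w k) /\ (forall k, -1 <= (a k).2 <= 1) /\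
  series w @ \oo --> (1 : R).

(* E_mu[g] for bounded g *)
Definition expect (X : Type) (w : nat -> R) (a : nat -> X * R) (g : X * R -> R) : R :=
  limn (series (fun k => w k * g (a k))).

(* realizability: Pr_mu[s(x) = y] = 1 for some s in S *)
Definition realizable (X : Type) (S : set (hyp X)) (w : nat -> R) (a : nat -> X * R) :=
  exists2 s, S s & forall k, 0 < w k -> s (a k).1 = Some (a k).2.

Definition prob_sample (X : Type) (n : nat) (w : nat -> R) (a : nat -> X * R)
  (P : ('I_n -> X * R) -> Prop) : \bar R :=
  \esum_(t in [set t : {ffun 'I_n -> nat} | P (fun i => a (t i))])
     ((\prod_(i < n) w (t i))%:E).

Definition learner (X : Type) (n : nat) := ('I_n -> X * R) -> X -> bool.

Definition DCorM (X : Type) (n : nat) (S B : set (hyp X)) (eps delta : R)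
  (L : learner X n) : Prop :=
  forall w a, distribution w a -> realizable S w a ->
    ((1 - delta)%:E <= @prob_sample X n w a (fun smp =>
       forall b, B b ->
         (expect w a (fun p => p.2 * sgn (L smp p.1))
          >= expect w a (fun p => gprod p.2 (b p.1)) - eps)%R))%E.

Definition DCorM_num_le (X : Type) (S B : set (hyp X)) (eps delta : R) (N : R) : Prop :=
  exists n : nat, (n%:R <= N) /\ exists L : learner X n, @DCorM X n S B eps delta L.

Definition logp (u : R) : R := ln (Num.max 2 u) / ln 2.

Definition m_VC (X : Type) (S B : set (hyp X)) (eta1 eta2 : R) : \bar R :=
  ereal_sup (range (fun theta : R =>
    VC2 (thr_const S 0 eta1) (thr_const B theta eta2))).

(* Main.v *)
Require Import Defs.
From HB Require Import structures.
From mathcomp Require Import all_boot all_order all_algebra.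
From mathcomp Require Import all_classical all_reals all_analysis.
From mathcomp Require Import Rstruct Rstruct_topology.
From mathcomp Require Import zify ring lra.
Import Order.TTheory GRing.Theory Num.Theory.
Import numFieldNormedType.Exports.
Local Open Scope classical_set_scope.
Local Open Scope ring_scope.
Set Implicit Arguments.
Unset Strict Implicit.
Unset Printing Implicit Defensive.

(** For a threshold theta, the partial functions equal to the sign of s wherever
    s^(0)_eta1 and b^(theta)_eta2 agree, and undefined elsewhere, form a class of VC
    dimension at most m.  Averaging over a grid of about 1/eta2 thresholds, a
    near-optimal b is matched by one of these partial functions p, up to 2 eta1 + 2 eta2.
    On the sample points where p is defined the labels are realizable, so boosting the
    one-inclusion-graph predictor gives a consistent majority vote that is determined
    by O(m log n) of the sample points.  The learner outputs the vote of largest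
    empirical correlation among all thresholds and all choices of those points; a
    Chernoff bound for the points not used by a vote, together with a union bound over
    the votes, controls its true correlation. *)

(** * One-inclusion graphs *)

(** The leave-one-out bound of the one-inclusion graph concerns only points where a single member is
    defined. The union bound then runs over names of votes, built from sample indices, which form a
    finite set fixed before the sample is drawn. Undefined points are harmless: there the comparator
    is credited with -|y|, the worst score of any prediction. The two logarithmic factors have
    different origins: the number of boosting rounds is about ln n, and each round contributes about
    d ln n to the logarithm of the number of votes. *)

Definition flip (I : finType) (i : I) (v : {set I}) : {set I} :=
  if i \in v then v :\ i else i |: v.

Lemma flipK (I : finType) (i : I) : involutive (flip i).
Proof.
move=> v; rewrite /flip; case: (boolP (i \in v)) => iv.
  by rewrite !finset.inE eqxx /= finset.setD1K.
by rewrite !finset.inE eqxx /= finset.setU1K.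
Qed.

Lemma in_flip (I : finType) (i j : I) (v : {set I}) :
  (j \in flip i v) = (j == i) (+) (j \in v).
Proof.
by rewrite /flip; case: (boolP (i \in v)) => iv; rewrite !finset.inE; case: eqP => [->|//]; rewrite ?iv ?(negPf iv).
Qed.

Definition shattered (I : finType) (V : {set {set I}}) (J : {set I}) :=
  [forall K : {set I}, (K \subset J) ==> [exists v in V, v :&: J == K]].

Lemma shatteredP (I : finType) (V : {set {set I}}) (J : {set I}) :
  reflect (forall K : {set I}, K \subset J -> exists2 v, v \in V & v :&: J = K)
          (shattered V J).
Proof.
apply: (iffP forallP) => H K.
  by move=> KJ; have /implyP/(_ KJ)/existsP[v /andP[vV /eqP]] := H K; exists v.
by apply/implyP => /H[v vV e]; apply/existsP; exists v; rewrite vV e eqxx.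
Qed.

Definition upedge (I : finType) (V : {set {set I}}) (j : I) (v : {set I}) :=
  [&& v \in V, j \notin v & j |: v \in V].

Lemma sum_split_coord (I : finType) (i : I) (f : {set I} -> nat) :
  (\sum_v f v = \sum_(v : {set I} | i \notin v) (f v + f (i |: v)))%N.
Proof.
rewrite (bigID (fun v : {set I} => i \notin v)) /= big_split /=; congr addn.
rewrite (reindex_onto (fun v => i |: v) (fun v => v :\ i)) /=; last first.
  by move=> v; rewrite negbK => iv; rewrite finset.setD1K.
apply: eq_bigl => v; rewrite negbK finset.setU11 /=.
apply/eqP/idP => [<-|iv]; first by rewrite !finset.inE eqxx.
by rewrite finset.setU1K.
Qed.

Lemma card_split_coord (I : finType) (i : I) (V : {set {set I}}) :
  (#|V| = \sum_(v : {set I} | i \notin v) ((v \in V) + (i |: v \in V)))%N.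
Proof. by rewrite -sum1_card big_mkcond /= (sum_split_coord i); apply: eq_bigr => v _; do 2 case: (_ \in V). Qed.

(** Deleting [i] splits [V] into its projection [U] and the set [W] of projected sets both of whose
    extensions lie in [V]. Then |V| = |U| + |W|, the edges in direction [i] number |W|, and the
    other edges are counted by those of [U] and [W]. Adding [i] to a set shattered by [W] gives one
    shattered by [V], so [W] has dimension at most d - 1. The set [D] carries the induction while
    the type [I] stays fixed. *)
Lemma edge_density (I : finType) (D : {set I}) (V : {set {set I}}) (d : nat) :
  (forall v, v \in V -> v \subset D) ->
  (forall J, shattered V J -> (#|J| <= d)%N) ->
  (\sum_j \sum_v upedge V j v <= d * #|V|)%N.
Proof.
have [k] := ubnP #|D|; elim: k => // k IH in D V d *; rewrite ltnS => leDk VD Vd.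
have [D0|[i iD]] := set_0Vmem D.
  rewrite big1 // => j _; rewrite big1 // => v _; rewrite /upedge.
  case: (boolP (j |: v \in V)) => [/VD|]; last by rewrite !andbF.
  by rewrite D0 finset.subset0 => /eqP/setP/(_ j); rewrite !finset.inE eqxx.
pose V0 := [set v in V | i \notin v]%SET.
pose V1 := [set v : {set I} | (i \notin v) && (i |: v \in V)]%SET.
pose U := (V0 :|: V1)%SET; pose W := (V0 :&: V1)%SET.
have ltD : (#|D :\ i| < k)%N by move: leDk; rewrite (cardsD1 i D) iD.
have UE (v : {set I}) : i \notin v -> (v \in U) = (v \in V) || (i |: v \in V).
  by move=> iv; rewrite !finset.inE iv andbT.
have WE (v : {set I}) : i \notin v -> (v \in W) = (v \in V) && (i |: v \in V).
  by move=> iv; rewrite !finset.inE iv andbT.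
have UN (v : {set I}) : v \in U -> i \notin v by rewrite !finset.inE => /orP[]/andP[].
have WU (v : {set I}) : v \in W -> v \in U by rewrite !finset.inE => /andP[->].
have UD (v : {set I}) : v \in U -> v \subset D :\ i.
  move=> vU; have iv := UN v vU; rewrite finset.subsetD1 iv andbT.
  move: vU; rewrite UE // => /orP[/VD//|/VD]; move=> H.
  by apply/fintype.subsetP => x xv; apply: (fintype.subsetP H); rewrite !finset.inE xv orbT.
have WD (v : {set I}) : v \in W -> v \subset D :\ i by move=> /WU/UD.
have cardV : #|V| = (#|U| + #|W|)%N.
  rewrite (card_split_coord i) (card_split_coord i U) (card_split_coord i W) -big_split /=.
  apply: eq_bigr => v iv.
  have h1 : (i |: v \in U) = false by apply/negP => /UN; rewrite finset.setU11.
  have h2 : (i |: v \in W) = false by apply/negP => /WU/UN; rewrite finset.setU11.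
  by rewrite h1 h2 UE // WE //; do 2 case: (_ \in V).
have cardW : #|W| = (\sum_v upedge V i v)%N.
  rewrite -sum1_card big_mkcond /=; apply: eq_bigr => v _; rewrite /upedge.
  case: (boolP (i \in v)) => iv /=.
    by rewrite andbF; case: ifP => // /WU/UN; rewrite iv.
  by rewrite WE //; case: ifP.
have edges j : j != i -> (\sum_v upedge V j v <=
    \sum_v upedge U j v + \sum_v upedge W j v)%N.
  move=> ji; rewrite !(sum_split_coord i) -big_split /=; apply: leq_sum => v iv.
  have h1 : upedge U j (i |: v) = false.
    by apply/negP => /and3P[/UN]; rewrite finset.setU11.
  have h2 : upedge W j (i |: v) = false.
    by apply/negP => /and3P[/WU/UN]; rewrite finset.setU11.
  have ijv : i \notin j |: v by rewrite !finset.inE negb_or eq_sym ji.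
  have -> : upedge V j (i |: v) = [&& i |: v \in V, j \notin v & i |: (j |: v) \in V].
    by rewrite /upedge !finset.inE negb_or ji /= finset.setUCA.
  rewrite h1 h2 /upedge !UE // !WE //.
  by case: (j \in v); do 4 case: (_ \in V).
have edges_i (Z : {set {set I}}) : (forall v, v \in Z -> v \in U) -> (\sum_v upedge Z i v = 0)%N.
  move=> ZU; apply: big1 => v _; case: (boolP (upedge Z i v)) => // /and3P[_ _ /ZU/UN].
  by rewrite finset.setU11.
have Ud J : shattered U J -> (#|J| <= d)%N.
  move=> /shatteredP UJ; apply: Vd; apply/shatteredP => K KJ.
  have iJ : i \notin J.
    by have [v /UN iv vJ] := UJ J (subxx _); apply: contra iv => iJ; move: iJ; rewrite -vJ finset.inE => /andP[].
  have [v vU vJ] := UJ K KJ; move: (vU); rewrite UE ?UN // => /orP[vV|vV].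
    by exists v.
  exists (i |: v) => //; rewrite -vJ; apply/setP => x; rewrite !finset.inE.
  by case: eqP => [->|//]; rewrite (negPf iJ) !andbF.
have Wd J : shattered W J -> (#|J| < d)%N.
  move=> /shatteredP WJ.
  have iJ : i \notin J.
    by have [v /WU/UN iv vJ] := WJ J (subxx _); apply: contra iv => iJ; move: iJ; rewrite -vJ finset.inE => /andP[].
  have <- : #|i |: J| = #|J|.+1 by rewrite cardsU1 iJ.
  apply: Vd; apply/shatteredP => K KJ.
  have [v vW vJ] : exists2 v, v \in W & v :&: J = K :\ i.
    by apply: WJ; rewrite finset.subDset.
  have iv : i \notin v by apply/UN/WU.
  move: vW; rewrite WE // => /andP[vV ivV].
  have e x : x != i -> (x \in J) && (x \in v) = (x \in K).
    by move=> xi; move/setP: vJ => /(_ x); rewrite !finset.inE xi andbC.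
  have KJ' x : x \in K -> x != i -> x \in J.
    by move=> /(fintype.subsetP KJ); rewrite !finset.inE => /orP[->//|].
  case: (boolP (i \in K)) => iK; [exists (i |: v)|exists v] => //; apply/setP => x; rewrite !finset.inE.
    case: (eqVneq x i) => [->|xi] /=; first by rewrite iK.
    by rewrite andbC e.
  case: (eqVneq x i) => [->|xi] /=; first by rewrite (negPf iK) (negPf iv).
  by rewrite andbC e.
have IHU := IH _ U d ltD UD Ud.
rewrite (bigD1 i) //= -cardW cardV mulnDr.
have le1 : (\sum_(j | j != i) \sum_v upedge V j v <=
    \sum_j \sum_v upedge U j v + \sum_j \sum_v upedge W j v)%N.
  rewrite -big_split /= [leqRHS](bigD1 i) //= edges_i // edges_i // add0n.
  exact: leq_sum.
case: d => [|d] in Vd Ud Wd IHU *.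
  have W0 : W = finset.set0.
    have [//|[v vW]] := set_0Vmem W.
    have : shattered W finset.set0.
      by apply/shatteredP => K; rewrite finset.subset0 => /eqP->; exists v; rewrite // finset.setI0.
    by move/Wd.
  have W0' : (\sum_j \sum_v upedge W j v)%N = 0%N.
    by rewrite big1 // => j _; rewrite big1 // => v _; rewrite /upedge W0 finset.inE.
  by rewrite {1}W0 cards0 !mul0n add0n; apply: leq_trans le1 _; rewrite W0' addn0.
have IHW := IH _ W d ltD WD Wd.
have := leq_add (leqnn #|W|) le1; move: IHU IHW; rewrite !mulSn.
set a := (\sum_(j | j != i) _)%N; set b := (\sum_j \sum_v upedge U j v)%N.
set c := (\sum_j \sum_v upedge W j v)%N.
lia.
Qed.

Definition degree (I : finType) (V : {set {set I}}) (v : {set I}) : nat :=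
  #|[set i | flip i v \in V]%SET|.

Lemma sum_degree (I : finType) (V : {set {set I}}) :
  (\sum_(v in V) degree V v = 2 * \sum_j \sum_v upedge V j v)%N.
Proof.
transitivity (\sum_j \sum_(v in V) (flip j v \in V : nat))%N.
  rewrite exchange_big /=; apply: eq_bigr => v _.
  by rewrite /degree -sum1dep_card big_mkcond; apply: eq_bigr => i _; case: ifP.
rewrite big_distrr /=; apply: eq_bigr => j _.
rewrite big_mkcond /= !(sum_split_coord j) big_distrr /=; apply: eq_bigr => v jv.
have e1 : flip j v = j |: v by rewrite /flip (negPf jv).
have e2 : flip j (j |: v) = v by rewrite -e1 flipK.
by rewrite e1 e2 /upedge jv finset.setU11 /= andbF; do 2 case: (_ \in V).
Qed.

Lemma exists_low_degree (I : finType) (V : {set {set I}}) (d : nat) :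
  V != finset.set0 -> (forall J, shattered V J -> (#|J| <= d)%N) ->
  exists2 v, v \in V & (degree V v <= 2 * d)%N.
Proof.
move=> V0 Vd; apply/exists_inP; apply: contraT; rewrite negb_exists_in => /forall_inP H.
have := edge_density (D := finset.setT) (fun v _ => finset.subsetT v) Vd.
have : (\sum_(v in V) (2 * d).+1 <= \sum_(v in V) degree V v)%N.
  by apply: leq_sum => v /H; rewrite -ltnNge.
rewrite sum_degree sum_nat_const; move: V0; rewrite -card_gt0.
nia.
Qed.

(* The set v stands for the labelling whose positive indices are v; the first
   clause says that the prediction at i ignores the label of i. *)
Definition leave_one_out_rule (I : finType) (V : {set {set I}}) (d : nat)
    (P : I -> {set I} -> bool) :=
  (forall i v, P i (flip i v) = P i v) /\
  (forall v, v \in V -> (#|[set i | P i v != (i \in v)]%SET| <= 2 * d)%N).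

(* Vertices are peeled off in order of low degree; on an edge the rule predicts
   the endpoint that is peeled last. *)
Lemma one_inclusion (I : finType) (V : {set {set I}}) (d : nat) :
  (forall J, shattered V J -> (#|J| <= d)%N) ->
  exists P, leave_one_out_rule V d P.
Proof.
have [k] := ubnP #|V|; elim: k => // k IH in V *; rewrite ltnS => leVk Vd.
have [->|V0] := eqVneq V finset.set0.
  by exists (fun _ _ => true); split=> // v; rewrite finset.inE.
have [v0 v0V deg0] := exists_low_degree V0 Vd.
have [|J /shatteredP VJ|P [Pflip Perr]] := IH (V :\ v0).
- by move: leVk; rewrite (cardsD1 v0 V) v0V.
- by apply: Vd; apply/shatteredP => K /VJ[v]; rewrite !finset.inE => /andP[_ vV]; exists v.
(* The override covers both ends of the pair v0, [flip i v0], which keeps the rule blind to the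
   label of [i]. The xor is the neighbour's label if the neighbour lies in [V] and that of v0
   otherwise, so v0 errs exactly in the directions counted by its degree. *)
exists (fun i u => if (u == v0) || (flip i u == v0)
                   then (flip i v0 \in V) (+) (i \in v0) else P i u).
split=> [i v|v vV]; first by rewrite flipK orbC Pflip.
case: (eqVneq v v0) => [->|vv0] /=.
  apply: leq_trans deg0; rewrite subset_leq_card //; apply/fintype.subsetP => i.
  by rewrite !finset.inE; case: (_ \in V); case: (_ \in v0).
apply: leq_trans (Perr v _); last by rewrite !finset.inE vv0.
rewrite subset_leq_card //; apply/fintype.subsetP => i; rewrite !finset.inE.
case: (eqVneq (flip i v) v0) => [<-|//].
by rewrite flipK vV in_flip eqxx /=; case: (i \in v).
Qed.

(** * Weak learners for partial classes *)

Definition upd (I : finType) (J : Type) (t : {ffun I -> J}) (i : I) (j : J) :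
  {ffun I -> J} := [ffun k => if k == i then j else t k].

Lemma prod_upd (A : comPzSemiRingType) (I J : finType) (w : J -> A)
    (t : {ffun I -> J}) (i : I) (j : J) :
  (\prod_k w (upd t i j k)) * w (t i) = (\prod_k w (t k)) * w j.
Proof.
rewrite (bigD1 i) //= [in RHS](bigD1 i) //= ffunE eqxx.
rewrite (eq_bigr (fun k => w (t k))); last by move=> k /negPf ki; rewrite ffunE ki.
by rewrite mulrC mulrA mulrAC.
Qed.

(* (t, j) |-> (upd t i j, t i) is an involution that preserves the weight. *)
Lemma resample (A : comPzSemiRingType) (I J : finType) (w : J -> A) (i : I)
    (F : {ffun I -> J} -> A) :
  \sum_(t : {ffun I -> J}) (\prod_k w (t k)) * \sum_j w j * F (upd t i j) =
  (\sum_j w j) * \sum_(t : {ffun I -> J}) (\prod_k w (t k)) * F t.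
Proof.
transitivity (\sum_(tj : {ffun I -> J} * J) (\prod_k w (tj.1 k)) * w tj.2 * F (upd tj.1 i tj.2)).
  rewrite -(pair_big xpredT xpredT (fun (t : {ffun I -> J}) j => (\prod_k w (t k)) * w j * F (upd t i j))) /=.
  by apply: eq_bigr => t _; rewrite big_distrr; apply: eq_bigr => j _; rewrite /= mulrA.
rewrite (reindex_inj (h := fun tj : {ffun I -> J} * J => (upd tj.1 i tj.2, tj.1 i))) /=; last first.
  apply: (can_inj (g := fun tj : {ffun I -> J} * J => (upd tj.1 i tj.2, tj.1 i))) => -[t j] /=.
  rewrite ffunE eqxx; congr pair; apply/ffunP => k; rewrite !ffunE.
  by case: eqP => [->|].
transitivity (\sum_(tj : {ffun I -> J} * J) w tj.2 * ((\prod_k w (tj.1 k)) * F tj.1)).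
  apply: eq_bigr => -[t j] _ /=; rewrite prod_upd mulrCA mulrA.
  have -> // : upd (upd t i j) i (t i) = t.
  by apply/ffunP => k; rewrite !ffunE; case: eqP => [->|].
rewrite -(pair_big xpredT xpredT (fun (t : {ffun I -> J}) j => w j * ((\prod_k w (t k)) * F t))) /=.
by rewrite exchange_big big_distrl /=; apply: eq_bigr => j _; rewrite big_distrr.
Qed.

Definition vc_le (X : Type) (P : set (X -> option bool)) (d : nat) :=
  forall k (e : 'I_k -> X), injective e ->
    (forall xi : 'I_k -> bool, exists2 p, P p & forall i, p (e i) = Some (xi i)) ->
    (k <= d)%N.

Definition patterns (X : Type) (P : set (X -> option bool)) (I : finType)
    (e : I -> X) : {set {set I}} :=
  [set v : {set I} | `[< exists2 p, P p & forall i, p (e i) = Some (i \in v) >]]%SET.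

(** [e] may repeat points, as samples do: two indices of one point cannot both lie in a shattered
    [J], since a pattern separating them would give that point two labels. Hence [e] is injective on
    [J]. *)
Lemma patterns_vc (X : Type) (P : set (X -> option bool)) (d : nat)
    (I : finType) (e : I -> X) (J : {set I}) :
  vc_le P d -> shattered (patterns P e) J -> (#|J| <= d)%N.
Proof.
move=> Pd /shatteredP PJ.
have PJ' (K : {set I}) : K \subset J ->
    exists2 p, P p & forall i, i \in J -> p (e i) = Some (i \in K).
  move=> /PJ[v]; rewrite finset.inE => /asboolP[p Pp pe] vJ.
  by exists p => // i iJ; rewrite pe -vJ finset.inE iJ andbT.
apply: (Pd _ (e \o @enum_val _ (mem J))) => [i j /= eij|xi].
  apply/enum_val_inj/eqP; apply: contraT => ne.
  have [|p _ pe] := PJ' [set enum_val i]%SET.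
    by rewrite finset.sub1set enum_valP.
  have := pe _ (enum_valP i); rewrite eij pe ?enum_valP // !finset.inE eqxx.
  by rewrite eq_sym (negPf ne).
have [|p Pp pe] := PJ' [set enum_val i | i : 'I_#|J| & xi i]%SET.
  by apply/fintype.subsetP => _ /imsetP[i _ ->]; exact: enum_valP.
exists p => // i; rewrite /= pe ?enum_valP // mem_imset; last exact: enum_val_inj.
by rewrite finset.inE.
Qed.

(** The choice depends on [V] and [d] alone, so the same rule serves whichever index is the test
    point. *)
Definition oi_rule (I : finType) (V : {set {set I}}) (d : nat) : I -> {set I} -> bool :=
  xget (fun _ _ => false) [set P | leave_one_out_rule V d P].

Lemma oi_ruleP (I : finType) (V : {set {set I}}) (d : nat) :
  (forall J, shattered V J -> (#|J| <= d)%N) -> leave_one_out_rule V d (oi_rule V d).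
Proof. by move=> /one_inclusion[P HP]; exact: (xgetPex _ (ex_intro _ P HP)). Qed.

(* The test point x is inserted at position i0 among the q labelled points z. *)
Definition weak (X : Type) (P : set (X -> option bool)) (d q : nat)
    (i0 : 'I_q.+1) (z : 'I_q -> X * bool) (x : X) : bool :=
  oi_rule (patterns P (fun i => if unlift i0 i is Some j then (z j).1 else x)) d i0
    [set i | if unlift i0 i is Some j then (z j).2 else false]%SET.

(** Reinserting each left-out point at its own position gives back the whole sequence [u], so all q
    + 1 predictions come from one rule on one pattern set. *)
Lemma weak_mistakes (X : Type) (P : set (X -> option bool)) (d q : nat)
    (p : X -> option bool) (u : 'I_q.+1 -> X) (c : 'I_q.+1 -> bool) :
  vc_le P d -> P p -> (forall i, p (u i) = Some (c i)) ->
  (\sum_i (weak P d i (fun j => (u (lift i j), c (lift i j))) (u i) != c i)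
    <= 2 * d)%N.
Proof.
move=> Pd Pp pu; pose v := [set i | c i]%SET.
have [Rflip Rerr] := oi_ruleP (V := patterns P u) (fun J => patterns_vc Pd).
have vP : v \in patterns P u.
  by rewrite finset.inE; apply/asboolP; exists p => // i; rewrite pu finset.inE.
apply: leq_trans (Rerr v vP); rewrite -sum1dep_card [leqRHS]big_mkcond /=.
apply: leq_sum => i _; rewrite finset.inE.
have -> : weak P d i (fun j => (u (lift i j), c (lift i j))) (u i) =
          oi_rule (patterns P u) d i v.
  rewrite /weak.
  have -> : (fun k => if unlift i k is Some j then u (lift i j) else u i) = u.
    by apply/funext => k; case: unliftP => [j ->|->].
  set v' := [set k | _]%SET.
  have v'E k : (k \in v') = (k != i) && (k \in v).
    rewrite !finset.inE; case: unliftP => [j ->|->]; last by rewrite eqxx.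
    by rewrite eq_sym neq_lift.
  (* [weak] gives the test point the placeholder label [false]; the set it queries is therefore [v]
     or [flip i v], between which the rule does not distinguish. *)
  case: (boolP (c i)) => ci.
    rewrite -Rflip; congr (oi_rule _ _ _ _); apply/setP => k.
    by rewrite in_flip v'E; case: eqP => [->|//]; rewrite finset.inE ci.
  congr (oi_rule _ _ _ _); apply/setP => k.
  by rewrite v'E; case: eqP => [->|//]; rewrite finset.inE (negPf ci).
by case: (_ != _).
Qed.

(** For 8d + 1 indices drawn from [w], at most 2d leave-one-out predictions fail, so the error
    averaged over positions and samples is at most 2d / (8d + 1) <= 1/4, and some choice does as
    well as the average. The position [i0] is part of the choice because the rule need not be
    symmetric in its indices. *)
Lemma weak_learner (R : realFieldType) (X : Type) (P : set (X -> option bool))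
    (d : nat) (p : X -> option bool) (J : finType) (x : J -> X) (y : J -> bool)
    (w : J -> R) :
  vc_le P d -> P p -> (forall j, 0 <= w j) ->
  (forall j, w j != 0 -> p (x j) = Some (y j)) -> 0 < \sum_j w j ->
  exists i0 : 'I_(8 * d).+1, exists t : {ffun 'I_(8 * d) -> J},
    4 * (\sum_j w j * (weak P d i0 (fun k => (x (t k), y (t k))) (x j) != y j)%:R)
      <= \sum_j w j.
Proof.
move=> Pd Pp w0 wp M0; set M := \sum_j w j; set q := (8 * d)%N.
pose err (i0 : 'I_q.+1) (t : {ffun 'I_q -> J}) : R :=
  \sum_j w j * (weak P d i0 (fun k => (x (t k), y (t k))) (x j) != y j)%:R.
pose W (t : {ffun 'I_q.+1 -> J}) := \prod_k w (t k).
pose rest i0 (t : {ffun 'I_q.+1 -> J}) : {ffun 'I_q -> J} := [ffun k => t (lift i0 k)].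
pose F i0 (t : {ffun 'I_q.+1 -> J}) : R :=
  (weak P d i0 (fun k => (x (rest i0 t k), y (rest i0 t k))) (x (t i0)) != y (t i0))%:R.
have W0 t : 0 <= W t by apply: prodr_ge0.
have sumW : \sum_t W t = M ^+ q.+1.
  by rewrite -[in RHS](card_ord q.+1) -prodr_const bigA_distr_bigA.
have restK i0 t j : rest i0 (upd t i0 j) = rest i0 t.
  by apply/ffunP => k; rewrite !ffunE eq_sym (negPf (neq_lift _ _)).
(* Of the q + 2 factors [M], q + 1 come from the drawn indices and one from the fresh test index,
   which [resample] moves into position [i0]. *)
have total : \sum_i0 \sum_t W t * err i0 (rest i0 t) <= (2 * d)%:R * M ^+ q.+2.
  have -> : \sum_i0 \sum_t W t * err i0 (rest i0 t) = M * \sum_t W t * \sum_i0 F i0 t.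
    transitivity (\sum_i0 M * \sum_t W t * F i0 t).
      apply: eq_bigr => i0 _; rewrite -(resample w i0 (F i0)); apply: eq_bigr => t _.
      congr (_ * _); apply: eq_bigr => j _.
      by rewrite /F restK ffunE eqxx.
    rewrite -big_distrr exchange_big /=; congr (_ * _); apply: eq_bigr => t _.
    by rewrite big_distrr.
  rewrite exprS mulrCA ler_wpM2l ?(ltW M0) //.
  rewrite -sumW mulrC big_distrl /=; apply: ler_sum => t _.
  have [Wt0|Wt0] := eqVneq (W t) 0; first by rewrite Wt0 !mul0r.
  apply: ler_wpM2l => //; rewrite /F -natr_sum ler_nat.
  have pt k : p (x (t k)) = Some (y (t k)).
    by apply: wp; apply: contraNneq Wt0 => e; rewrite /W (bigD1 k) //= e mul0r.
  rewrite (eq_bigr (fun i => (weak P d i (fun j => (x (t (lift i j)), y (t (lift i j))))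
     (x (t i)) != y (t i) : nat))); last first.
    move=> i _; rewrite (_ : (fun k => _) = (fun j => (x (t (lift i j)), y (t (lift i j))))) //.
    by apply/funext => k; rewrite ffunE.
  exact: (weak_mistakes Pd Pp pt).
have [[i0 [t Ht]]|H] := pselect (exists i0, exists t, q.+1%:R * err i0 t <= (2 * d)%:R * M).
  exists i0, t; rewrite -/(err i0 t).
  have e0 : 0 <= err i0 t by apply: sumr_ge0 => j _; rewrite mulr_ge0.
  move: Ht; rewrite /q; move: (err i0 t) e0 => e e0; case: (d) => [|d'].
    by rewrite muln0 mul0r mul1r => e1; have := ltW M0; rewrite -/M; lra.
  have d1 : (0 : R) < d'.+1%:R by rewrite ltr0Sn.
  rewrite -addn1 natrD !natrM => Ht; rewrite -(ler_pM2l d1); nra.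
exfalso; move: total; rewrite leNgt => /negP; apply.
have lt i0 t : (2 * d)%:R * M < q.+1%:R * err i0 t.
  by rewrite ltNge; apply/negP => h; apply: H; exists i0, t.
have q0 : (0 : R) < q.+1%:R by rewrite ltr0Sn.
rewrite -(ltr_pM2l q0).
have -> : q.+1%:R * ((2 * d)%:R * M ^+ q.+2) = \sum_(i0 < q.+1) (\sum_t W t * ((2 * d)%:R * M)).
  by rewrite sumr_const card_ord -mulr_natl -big_distrl /= sumW exprS; ring.
rewrite [ltRHS]big_distrr /=.
apply: ltr_sum => [|i0 _].
  by apply/hasP; exists ord0; rewrite // mem_index_enum.
rewrite [ltRHS]big_distrr /=.
have [t Wt] : exists t, 0 < W t.
  have : \sum_t W t != 0 by rewrite sumW expf_neq0 // gt_eqF.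
  apply: contraNP => h; apply/eqP; apply: big1 => t _; apply/eqP.
  by move: (W0 t); rewrite le_eqVlt eq_sym => /orP[//|Wt]; case: h; exists t.
rewrite (bigD1 t) //= [ltRHS](bigD1 t) //=; apply: ltr_leD.
  by rewrite [ltRHS]mulrCA ltr_pM2l.
by apply: ler_sum => t' _; rewrite [leRHS]mulrCA ler_wpM2l // ltW.
Qed.

(** * Boosting *)

(** Multiplicative weights: each mistake multiplies the weight of a point by 4. As at most a quarter
    of the mass is misclassified, the total grows per round by at most 1 + 3/4 = 7/4. *)
Lemma boosting (R : realFieldType) (J : finType) (Y : Type) (y0 : Y)
    (T : {set J}) (err : Y -> J -> bool) :
  (forall w : J -> R, (forall j, 0 <= w j) -> (forall j, w j != 0 -> j \in T) ->
     0 < \sum_j w j -> exists y, 4 * (\sum_j w j * (err y j)%:R) <= \sum_j w j) ->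
  forall l, exists s : l.-tuple Y,
    4 ^+ l * \sum_(j in T) 4 ^+ count (err^~ j) s <= 7 ^+ l * #|T|%:R :> R.
Proof.
move=> weak_err; elim=> [|l [s Hs]].
  by exists [tuple]; rewrite !expr0 !mul1r sumr_const.
(* With [T] empty the total weight is 0 and [weak_err] does not apply; the default [y0] fills the
   tuple. *)
have [T0|T0] := set_0Vmem T.
  by exists (nseq_tuple l.+1 y0); rewrite T0 cards0 mulr0 big_set0 mulr0.
pose w (j : J) : R := if j \in T then 4 ^+ count (err^~ j) s else 0.
have wE : \sum_j w j = \sum_(j in T) 4 ^+ count (err^~ j) s by rewrite [RHS]big_mkcond.
have [|||y Hy] := weak_err w.
- by move=> j; rewrite /w; case: ifP => // _; rewrite exprn_ge0.
- by move=> j; rewrite /w; case: ifP => //; rewrite eqxx.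
- case: T0 => j jT; rewrite wE (bigD1 j) //= ltr_pwDl ?exprn_gt0 //.
  by apply: sumr_ge0 => i _; rewrite exprn_ge0.
exists [tuple of y :: s].
have -> : \sum_(j in T) 4 ^+ count (err^~ j) [tuple of y :: s] =
    \sum_j w j + 3 * \sum_j w j * (err y j)%:R :> R.
  rewrite big_distrr -big_split big_mkcond; apply: eq_bigr => j _ /=.
  rewrite /w; case: ifP => _; last by ring.
  by rewrite exprD; case: (err y j) => /=; ring.
move: Hs Hy; rewrite -wE !exprS.
set M := \sum_j w j; set E := \sum_j w j * _; set a := 4 ^+ l; set b := 7 ^+ l => Hs Hy.
have a0 : 0 < a by rewrite exprn_gt0.
have : a * (4 * E) <= a * M by rewrite ler_pM2l.
lra.
Qed.

(** A weak hypothesis is named by its insertion position and the indices of its 8d training points,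
    so the set of names does not depend on the sample. *)
Definition weak_index (d n : nat) := ('I_(8 * d).+1 * {ffun 'I_(8 * d) -> 'I_n})%type.

Definition boost_index (d n l : nat) := (l.-tuple (weak_index d n)).

Definition vote (X : Type) (P : set (X -> option bool)) (d n l : nat)
    (s : boost_index d n l) (z : 'I_n -> X * bool) (x : X) : bool :=
  (l < 2 * count (fun y : weak_index d n => weak P d y.1 (z \o y.2) x) s)%N.

(** A point of [T] misclassified in at least half of the rounds would have weight at least 4^(l/2) =
    2^l, above the total (7/4)^l n allowed by [boosting]. Points outside [T] get no weight, and
    nothing is claimed there. *)
Lemma compression (X : Type) (P : set (X -> option bool)) (d n l : nat)
    (p : X -> option bool) (z : 'I_n -> X * bool) :
  vc_le P d -> P p -> (0 < n)%N -> (7 ^ l * n < 8 ^ l)%N ->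
  exists s : boost_index d n l,
    forall i, p (z i).1 = Some (z i).2 -> vote P s z (z i).1 = (z i).2.
Proof.
move=> Pd Pp n0 nl; pose T := [set i | p (z i).1 == Some (z i).2]%SET.
pose err (y : weak_index d n) i := weak P d y.1 (z \o y.2) (z i).1 != (z i).2.
have [|s Hs] := @boosting rat _ (weak_index d n) (ord0, [ffun=> Ordinal n0]) T err _ l.
  move=> w w0 wT M0.
  have [|i0 [t Ht]] := weak_learner (x := fun i => (z i).1) (y := fun i => (z i).2) Pd Pp w0 _ M0.
    by move=> j /wT; rewrite finset.inE => /eqP.
  exists (i0, t); move: Ht.
  by rewrite (_ : (fun k => _) = z \o t) //; apply/funext => k /=; case: (z (t k)).
have few i : i \in T -> (2 * count (err^~ i) s < l)%N.
  move=> iT; rewrite ltnNge; apply/negP => le.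
  have : (4 ^ l * 2 ^ l <= 7 ^ l * n)%N.
    rewrite -(ler_nat rat) !natrM !natrX; apply: le_trans (_ : 7 ^+ l * #|T|%:R <= _); last first.
      by rewrite ler_wpM2l ?exprn_ge0 // ler_nat -[n in leqRHS]card_ord max_card.
    apply: le_trans Hs; rewrite ler_wpM2l ?exprn_ge0 // (bigD1 i) //= ler_wpDr //.
      by apply: sumr_ge0 => j _; rewrite exprn_ge0.
    rewrite (_ : 4 = 2 ^+ 2) // -exprM ler_weXn2l //.
  by rewrite -expnMn leqNgt nl.
exists s => i zi; have {few} := few i; rewrite finset.inE zi eqxx => /(_ isT).
rewrite /vote; set c1 := count _ _; set c2 := count _ _.
have : (if (z i).2 then c1 + c2 = l else c1 = c2)%N.
  rewrite /c1 /c2; case e: (z i).2.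
    rewrite -[RHS](size_tuple s) -(count_predC (err^~ i) s); congr addn.
    by apply: eq_count => y; rewrite /= /err e; case: weak.
  by apply: eq_count => y; rewrite /err e; case: weak.
by case: (z i).2 => e h; apply/idP; lia.
Qed.

Definition support (d n l : nat) (s : boost_index d n l) : {set 'I_n} :=
  [set i | i \in flatten [seq codom y.2 | y : weak_index d n <- s]]%SET.

Lemma card_support (d n l : nat) (s : boost_index d n l) : (#|support s| <= l * (8 * d))%N.
Proof.
rewrite cardsE; apply: leq_trans (card_size _) _.
rewrite size_flatten /shape -map_comp sumnE big_map.
rewrite (eq_bigr (fun _ => 8 * d)%N); last by move=> y _ /=; rewrite size_codom card_ord.
by rewrite big_const_seq count_predT iter_addn_0 size_tuple mulnC.
Qed.

Lemma vote_support (X : Type) (P : set (X -> option bool)) (d n l : nat)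
    (s : boost_index d n l) (z z' : 'I_n -> X * bool) :
  {in support s, z =1 z'} -> vote P s z = vote P s z'.
Proof.
move=> zz'; apply/funext => x; congr (_ < 2 * _)%N; apply: eq_in_count => y ys.
congr (weak P d y.1 _ x); apply/funext => k /=; apply: zz'.
by rewrite finset.inE; apply/flatten_mapP; exists y => //; exact: codom_f.
Qed.

(** * Concentration *)

(** From 1 - x <= e^(-x) and (1 - x)(1 + x + 2x^2) = 1 + x^2 (1 - 2x) >= 1. *)
Lemma expR_le_quadratic (R : realType) (x : R) : x <= 1 / 2 -> expR x <= 1 + x + 2 * x ^+ 2.
Proof.
move=> x2; have := expR_ge1Dx (- x); rewrite expRN => h.
have e0 := expR_gt0 x.
have h1 : (1 - x) * expR x <= 1.
  by rewrite -[leRHS](mulVf (lt0r_neq0 e0)) ler_pM2r.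
have h2 : 1 <= (1 - x) * (1 + x + 2 * x ^+ 2).
  have : 0 <= x ^+ 2 * (1 - 2 * x) by rewrite mulr_ge0 ?sqr_ge0 //; lra.
  by rewrite expr2; lra.
by rewrite -(@ler_pM2l _ (1 - x)); lra.
Qed.

Definition mean (R : realType) (Om : finType) (w g : Om -> R) : R := \sum_o w o * g o.

Section Mean.
Context (R : realType) (Om : finType) (w : Om -> R).
Hypothesis (w0 : forall o, 0 <= w o) (w1 : \sum_o w o = 1).

Lemma mean_le (f g : Om -> R) : (forall o, 0 < w o -> f o <= g o) -> mean w f <= mean w g.
Proof.
move=> fg; apply: ler_sum => o _; have := w0 o; rewrite le_eqVlt => /orP[/eqP<-|wo].
  by rewrite !mul0r.
by rewrite ler_pM2l // fg.
Qed.

Lemma mean_cst (c : R) : mean w (fun _ => c) = c.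
Proof. by rewrite /mean -big_distrl /= w1 mul1r. Qed.

Lemma mean_norm_le1 (g : Om -> R) : (forall o, `|g o| <= 1) -> `|mean w g| <= 1.
Proof.
move=> g1; rewrite ler_norml -{1}(mean_cst (-1)) -{2}(mean_cst 1).
by apply/andP; split; apply: mean_le => o _; have := g1 o; rewrite ler_norml => /andP[].
Qed.

(** The deviation x = g - mean lies in [-2, 2]: hence lam <= 1/4 keeps the exponent below 1/2, 2
    lam^2 x^2 is at most 8 lam^2, and the linear term averages to 0. *)
Lemma mean_expR_centered (g : Om -> R) (lam : R) : (forall o, `|g o| <= 1) ->
  0 <= lam <= 1 / 4 -> mean w (fun o => expR (lam * (g o - mean w g))) <= 1 + 8 * lam ^+ 2.
Proof.
move=> g1 /andP[l0 l4]; set m := mean w g.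
have m1 : `|m| <= 1 by exact: mean_norm_le1.
apply: (@le_trans _ _ (mean w (fun o => 1 + lam * (g o - m) + 8 * lam ^+ 2))).
  apply: mean_le => o _; move: (g1 o) m1; rewrite !ler_norml => /andP[? ?] /andP[? ?].
  set x := g o - m; have [x2 x2'] : x <= 2 /\ -2 <= x by rewrite /x; split; lra.
  have lx : lam * x <= lam * 2 by rewrite ler_wpM2l.
  apply: le_trans (expR_le_quadratic _) _; first by lra.
  rewrite lerD2l exprMn mulrCA (_ : 8 * _ = lam ^+ 2 * 8); last by ring.
  rewrite ler_wpM2l ?sqr_ge0 //.
  have : 0 <= (2 - x) * (2 + x) by rewrite mulr_ge0 //; lra.
  by rewrite expr2; lra.
rewrite /mean (eq_bigr (fun o => (1 - lam * m + 8 * lam ^+ 2) * w o + lam * (w o * g o))).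
  by rewrite big_split /= -!big_distrr /= w1 -/(mean w g) -/m; lra.
by move=> o _; ring.
Qed.

Definition prod_weight (n : nat) (t : {ffun 'I_n -> Om}) : R := \prod_i w (t i).

Lemma prod_weight_ge0 (n : nat) (t : {ffun 'I_n -> Om}) : 0 <= prod_weight t.
Proof. exact: prodr_ge0. Qed.

Lemma sum_prod_weight (n : nat) : \sum_(t : {ffun 'I_n -> Om}) prod_weight t = 1.
Proof.
by rewrite -(bigA_distr_bigA (fun _ : 'I_n => w)) /= big1 // => i _; rewrite w1.
Qed.

(* The function G t may depend on the sample points with index in U; the other
   points are integrated out one at a time. *)
Lemma mgf_bound (n : nat) (U : {set 'I_n}) (G : {ffun 'I_n -> Om} -> Om -> R) (lam : R)
    (s : seq 'I_n) :
  (forall t o, `|G t o| <= 1) -> 0 <= lam <= 1 / 4 ->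
  (forall t i o, i \notin U -> G (upd t i o) = G t) ->
  uniq s -> {in s, forall i, i \notin U} ->
  \sum_t prod_weight t * \prod_(i <- s) expR (lam * (G t (t i) - mean w (G t)))
    <= (1 + 8 * lam ^+ 2) ^+ size s.
Proof.
move=> G1 lam4 GU; elim: s => [|i s IH] /=.
  move=> _ _; rewrite expr0 -[leRHS](sum_prod_weight n) le_eqVlt; apply/orP; left; apply/eqP.
  by apply: eq_bigr => t _; rewrite big_nil mulr1.
move=> /andP[si us] sU; have iU : i \notin U by apply: sU; rewrite mem_head.
rewrite -[X in X <= _]mul1r -{1}w1 -(resample w i) exprS.
have IH' : _ <= _ := IH us (fun j js => sU j (mem_behead (s := i :: s) js)).
have c0 : 0 <= 1 + 8 * lam ^+ 2 by have := sqr_ge0 lam; lra.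
apply: le_trans (ler_wpM2l c0 IH').
rewrite big_distrr /=; apply: ler_sum => t _.
rewrite [leRHS]mulrCA ler_wpM2l ?prod_weight_ge0 //.
set K := \prod_(j <- s) _.
have K0 : 0 <= K by apply: prodr_ge0 => j _; exact: expR_ge0.
apply: le_trans (ler_wpM2r K0 (mean_expR_centered (G1 t) lam4)).
rewrite le_eqVlt; apply/orP; left; apply/eqP; rewrite /mean big_distrl /=.
apply: eq_bigr => o _; rewrite -mulrA; congr (_ * _).
rewrite big_cons GU // ffunE eqxx; congr (_ * _); apply: eq_big_seq => j js.
by rewrite ffunE; case: eqP => // ji; rewrite -ji js in si.
Qed.

(** The indices in [U], on which [G t] may depend, contribute at most 2|U| <= n eps / 2; the
    remaining ones must then deviate by n eps / 2, to which the exponential moment bound applies. *)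
Lemma concentration (n : nat) (U : {set 'I_n}) (G : {ffun 'I_n -> Om} -> Om -> R) (eps : R) :
  (forall t o, `|G t o| <= 1) ->
  (forall t i o, i \notin U -> G (upd t i o) = G t) ->
  0 < eps <= 1 -> 4 * #|U|%:R <= n%:R * eps ->
  \sum_(t | n%:R * eps <= \sum_i (G t (t i) - mean w (G t))) prod_weight t
    <= expR (- (n%:R * eps ^+ 2 / 128)).
Proof.
move=> G1 GU /andP[e0 e1] Un.
(* This [lam] minimises 8 lam^2 - lam eps / 2, with minimum - eps^2 / 128. *)
pose lam := eps / 32; pose s := enum (~: U)%SET.
pose D t i := G t (t i) - mean w (G t).
have lam4 : 0 <= lam <= 1 / 4 by rewrite /lam; lra.
have D2 t i : D t i <= 2.
  have := mean_norm_le1 (G1 t); have := G1 t (t i).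
  by rewrite /D !ler_norml => /andP[? ?] /andP[? ?]; lra.
apply: (@le_trans _ _ (\sum_t prod_weight t *
    (expR (- (lam * (n%:R * eps / 2))) * \prod_(i <- s) expR (lam * D t i)))).
  rewrite big_mkcond /=; apply: ler_sum => t _; case: ifP => h; last first.
    by rewrite mulr_ge0 ?prod_weight_ge0 // mulr_ge0 ?expR_ge0 // prodr_ge0 // => i _; exact: expR_ge0.
  rewrite ler_peMr ?prod_weight_ge0 // -expR_sum -exp.expRD -[leLHS]exp.expR0 ler_expR.
  rewrite -big_distrr /= -mulrN -mulrDr mulr_ge0 //; first by case/andP: lam4.
  have : \sum_(i in U) D t i <= 2 * #|U|%:R.
    by rewrite mulr_natr -sumr_const; apply: ler_sum.
  have -> : \sum_(i <- s) D t i = \sum_(i | i \notin U) D t i.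
    by rewrite /s big_enum; apply: eq_bigl => i; rewrite finset.inE.
  by move: h; rewrite (bigID (mem U)) /= -!/(D t _) /D; lra.
rewrite (eq_bigr (fun t => expR (- (lam * (n%:R * eps / 2))) *
    (prod_weight t * \prod_(i <- s) expR (lam * D t i)))); last by move=> t _; rewrite mulrCA.
rewrite -big_distrr /=.
have s1 : (size s <= n)%N by rewrite -[n in leqRHS]card_ord -cardE max_card.
have mgf : \sum_t prod_weight t * \prod_(i <- s) expR (lam * D t i) <= expR (8 * lam ^+ 2 * n%:R).
  apply: le_trans (mgf_bound G1 lam4 GU (enum_uniq _) _) _.
    by move=> i; rewrite mem_enum finset.inE.
  have c1 : 1 <= 1 + 8 * lam ^+ 2 by have := sqr_ge0 lam; lra.
  apply: le_trans (ler_weXn2l c1 s1) _.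
  rewrite (mulrC _ n%:R) expRM_natl lerXn2r ?nnegrE ?expR_ge0 //; first by lra.
  exact: expR_ge1Dx.
apply: le_trans (ler_wpM2l (expR_ge0 _) mgf) _; rewrite -exp.expRD ler_expR /lam.
by rewrite le_eqVlt; apply/orP; left; apply/eqP; field.
Qed.

End Mean.

(** * Truncation of discrete distributions *)

Lemma prob_sample_ge (X : Type) (n N : nat) (w : nat -> R) (a : nat -> X * R)
    (P : ('I_n -> X * R) -> Prop) :
  (((\sum_(t : {ffun 'I_n -> 'I_N} | `[< P (fun i => a (t i)) >]) \prod_i w (t i))%:E)
    <= prob_sample w a P)%E.
Proof.
pose emb (t : {ffun 'I_n -> 'I_N}) : {ffun 'I_n -> nat} := [ffun i => val (t i)].
have emb_inj : injective emb.
  by move=> t t' /ffunP tt'; apply/ffunP => i; apply/val_inj; have := tt' i; rewrite !ffunE.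
have embE t : (fun i => a (emb t i)) = fun i => a (t i) by apply/funext => i; rewrite ffunE.
pose r := [seq emb t | t <- enum (fun t : {ffun 'I_n -> 'I_N} => `[< P (fun i => a (t i)) >])].
apply: esum_ge; exists [set` r].
  split; first exact: finite_seq.
  move=> x /= /mapP[t]; rewrite mem_enum => /asboolP Pt xt.
  by rewrite xt embE.
rewrite -fsbig_seq ?map_inj_uniq ?enum_uniq // big_map big_enum /= sumEFin lee_fin.
rewrite le_eqVlt; apply/orP; left; apply/eqP; apply: eq_bigr => t _.
by apply: eq_bigr => i _; rewrite ffunE.
Qed.

Lemma partial_sum_le (K : realType) (w : nat -> K) (l : K) (N : nat) :
  (forall k, 0 <= w k) -> series w @ \oo --> l -> series w N <= l.
Proof.
move=> w0 cv; have <- : limn (series w) = l by apply/cvg_lim.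
apply: nondecreasing_cvgn_le; last by apply/cvg_ex; exists l.
by apply: nondecreasing_series => k _ _; exact: w0.
Qed.

Lemma dominated_tail (K : realType) (w u : nat -> K) (l : K) (N : nat) :
  (forall k, `|u k| <= w k) -> series w @ \oo --> l ->
  `|limn (series u) - series u N| <= l - series w N.
Proof.
move=> uw cv; have w0 k : 0 <= w k by apply: le_trans (uw k).
have cvg_w : cvgn (series w) by apply/cvg_ex; exists l.
have cvg_u : cvgn (series u).
  apply: normed_cvg; apply: (@series_le_cvg _ _ w) => // k; exact: normr_ge0.
have near_u : \forall n \near \oo, `|series u n - series u N| <= l - series w N.
  near=> n; have Nn : (N <= n)%N by near: n; exists N.
  rewrite sub_series_geq //; apply: (@le_trans _ _ (series w n - series w N)).
    rewrite sub_series_geq //; apply: le_trans (ler_norm_sum _ _ _) _.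
    exact: ler_sum.
  by rewrite lerB // partial_sum_le.
rewrite ler_distl; apply/andP; split.
  apply: limr_ge => //; near=> n.
  by have : `|series u n - series u N| <= l - series w N; [near: n|rewrite ler_distl => /andP[]].
apply: limr_le => //; near=> n.
by have : `|series u n - series u N| <= l - series w N; [near: n|rewrite ler_distl => /andP[]].
Unshelve. all: by end_near. Qed.

Lemma exists_large_partial_sum (K : realType) (w : nat -> K) (n : nat) (tau delta : K) :
  series w @ \oo --> (1 : K) -> 0 < tau -> 0 < delta ->
  exists N, [/\ 1 - tau <= series w N, 1 - delta <= series w N ^+ n & 0 < series w N].
Proof.
move=> cv t0 d0.
have cvn : series w N ^+ n @[N --> \oo] --> (1 : K).
  have := @exprn_continuous _ n (1 : K); rewrite /continuous_at expr1n => h.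
  exact: (cvg_comp _ _ cv h).
near \oo => N; exists N; split; near: N.
- by apply: (cvgr_ge _ cv); lra.
- by apply: (cvgr_ge _ cvn); lra.
- by apply: (cvgr_gt _ cv); lra.
Unshelve. all: by end_near. Qed.

Section Truncation.
Context (X : Type) (w : nat -> R) (a : nat -> X * R).
Hypothesis Dwa : Defs.distribution w a.

Let w0 k : 0 <= w k. Proof. by case: Dwa. Qed.

Lemma partial_mass_le1 (N : nat) : series w N <= 1.
Proof. by case: Dwa => _ [_]; exact: partial_sum_le. Qed.

Lemma expect_tail (g : X * R -> R) (N : nat) : (forall k, `|g (a k)| <= 1) ->
  `|expect w a g - series (fun k => w k * g (a k)) N| <= 1 - series w N.
Proof.
move=> g1; apply: dominated_tail => [k|]; last by case: Dwa => _ [].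
by rewrite normrM ger0_norm // ler_piMr.
Qed.

(** Conditioning on the first [N] atoms makes the sample space finite, as resampling and
    concentration require. *)
Definition trunc_weight (N : nat) (k : 'I_N) : R := w k / series w N.

Lemma trunc_weight_ge0 (N : nat) (k : 'I_N) : 0 <= trunc_weight k.
Proof. by rewrite mulr_ge0 // invr_ge0 // sumr_ge0. Qed.

Lemma sum_trunc_weight (N : nat) : 0 < series w N -> \sum_(k < N) trunc_weight k = 1.
Proof. by move=> S0; rewrite -mulr_suml -(big_mkord xpredT w) divff ?gt_eqF. Qed.

(** One 1 - [series w N] is the discarded tail, the other the effect of renormalising. *)
Lemma expect_mean (g : X * R -> R) (N : nat) : 0 < series w N ->
  (forall k, `|g (a k)| <= 1) ->
  `|expect w a g - mean (@trunc_weight N) (fun k => g (a k))| <= 2 * (1 - series w N).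
Proof.
move=> S0 g1; have tail := expect_tail N g1.
set m := mean _ _.
have m1 : `|m| <= 1.
  by apply: mean_norm_le1 => //; [exact: trunc_weight_ge0|exact: sum_trunc_weight].
have sE : series (fun k => w k * g (a k)) N = series w N * m.
  rewrite /series /= big_mkord /m /mean big_distrr /=; apply: eq_bigr => k _.
  by rewrite mulrA; congr (_ * _); rewrite /trunc_weight mulrCA divff ?mulr1 // gt_eqF.
move: tail; rewrite sE; have := partial_mass_le1 N.
move: S0 m1; set S := series w N; rewrite !ler_norml => S0 /andP[m1 m1'] S1 /andP[h1 h2].
have h3 : (1 - S) * m <= 1 - S by rewrite ler_piMr // subr_ge0.
have h4 : - (1 - S) <= (1 - S) * m.
  by rewrite -[leLHS]mulrN1 ler_wpM2l // subr_ge0.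
by apply/andP; split; lra.
Qed.

(** All [n] draws fall among the first [N] atoms with probability [series w N ^+ n], and given this
    they are i.i.d. from the truncated weights. *)
Lemma prob_sample_trunc (n N : nat) (P : ('I_n -> X * R) -> Prop) (c : R) :
  0 < series w N ->
  \sum_(t : {ffun 'I_n -> 'I_N} | ~~ `[< P (fun i => a (t i)) >])
    prod_weight (@trunc_weight N) t <= c ->
  ((series w N ^+ n * (1 - c))%:E <= prob_sample w a P)%E.
Proof.
move=> S0 bad; apply: le_trans (prob_sample_ge N w a P); rewrite lee_fin.
have wE (t : {ffun 'I_n -> 'I_N}) :
    \prod_i w (t i) = series w N ^+ n * prod_weight (@trunc_weight N) t.
  rewrite -[n in _ ^+ n]card_ord -prodr_const -big_split /=; apply: eq_bigr => i _.
  by rewrite /trunc_weight mulrCA divff ?mulr1 // gt_eqF.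
rewrite (eq_bigr _ (fun t _ => wE t)) -big_distrr /=.
rewrite ler_wpM2l ?exprn_ge0 ?(ltW S0) //.
have := sum_prod_weight (sum_trunc_weight S0) n.
rewrite (bigID (fun t : {ffun 'I_n -> 'I_N} => `[< P (fun i => a (t i)) >])) /=; lra.
Qed.

End Truncation.

(** * Empirical correlation maximization *)

Definition label (X : Type) (p : X * R) : X * bool := (p.1, 0 < p.2).

Definition corr (X : Type) (f : X -> bool) (p : X * R) : R := p.2 * sgn (f p.1).

(** The correlation guaranteed by a predictor that is right wherever [q] is defined and possibly
    wrong everywhere else. *)
Definition agreement (X : Type) (q : X -> option bool) (p : X * R) : R :=
  if q p.1 is Some _ then `|p.2| else - `|p.2|.

Definition candidate (X : Type) (K d n l : nat) (P : 'I_K -> set (X -> option bool))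
    (th : 'I_K * boost_index d n l) (z : 'I_n -> X * R) : X -> bool :=
  vote (P th.1) th.2 (fun i => label (z i)).

Definition erm (X : Type) (K d n l : nat) (P : 'I_K -> set (X -> option bool))
    (th0 : 'I_K * boost_index d n l) : learner X n :=
  fun z => candidate P [arg max_(th > th0) \sum_i corr (candidate P th z) (z i)]%O z.

Lemma norm_corr_le1 (X : Type) (f : X -> bool) (p : X * R) : -1 <= p.2 <= 1 -> `|corr f p| <= 1.
Proof.
rewrite -ler_norml /corr normrM /sgn => h.
by rewrite (_ : `|if _ then _ else _| = 1) ?mulr1 //; case: ifP => _; rewrite ?normrN normr1.
Qed.

Lemma norm_agreement_le1 (X : Type) (q : X -> option bool) (p : X * R) :
  -1 <= p.2 <= 1 -> `|agreement q p| <= 1.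
Proof. by rewrite -ler_norml /agreement; case: (q _) => [_|]; rewrite ?normrN normr_id. Qed.

Lemma agreement_le_corr (X : Type) (q : X -> option bool) (f : X -> bool) (p : X * R) :
  (forall b, q p.1 = Some b -> f p.1 = (0 < p.2)) -> agreement q p <= corr f p.
Proof.
rewrite /agreement /corr /sgn; case: (q p.1) => [b /(_ b erefl) ->|_].
  by case: ltP => h; rewrite ?mulr1 ?mulrN1; [rewrite gtr0_norm|rewrite ler0_norm].
by case: ifP => _; rewrite ?mulr1 ?mulrN1 ?lerN2 ?ler_norm // lerNl ler_normr lexx orbT.
Qed.

Lemma candidate_upd (X : Type) (K d n l : nat) (P : 'I_K -> set (X -> option bool))
    (th : 'I_K * boost_index d n l) (Om : finType) (a : Om -> X * R)
    (t : {ffun 'I_n -> Om}) (i : 'I_n) (o : Om) : i \notin support th.2 ->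
  candidate P th (fun k => a (upd t i o k)) = candidate P th (fun k => a (t k)).
Proof.
move=> iU; apply: vote_support => k kU; rewrite ffunE; case: eqP => // ki.
by rewrite -ki kU in iU.
Qed.

(** The bad events are that the empirical agreement of [p] is too low and, for each candidate, that
    its empirical correlation is too high. Outside them, the true agreement of [p], its empirical
    agreement, the empirical correlation of the compressed vote, that of the maximiser and the true
    correlation of the maximiser form a chain losing [eps] at each end. The compressed vote and the
    maximiser depend on the sample, hence the union over all names. *)
Lemma erm_generalizes (X : Type) (K d n l : nat) (P : 'I_K -> set (X -> option bool))
    (th0 : 'I_K * boost_index d n l) (Om : finType) (w : Om -> R) (a : Om -> X * R)
    (j : 'I_K) (p : X -> option bool) (eps : R) :
  (forall k, vc_le (P k) d) -> P j p -> (0 < n)%N -> (7 ^ l * n < 8 ^ l)%N ->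
  (forall o, 0 <= w o) -> \sum_o w o = 1 -> (forall o, -1 <= (a o).2 <= 1) ->
  (forall o b, 0 < w o -> p (a o).1 = Some b -> b = (0 < (a o).2)) ->
  0 < eps <= 1 -> 4 * (l * (8 * d))%:R <= n%:R * eps ->
  \sum_(t : {ffun 'I_n -> Om} | ~~ (mean w (fun o => agreement p (a o)) - 2 * eps <=
      mean w (fun o => corr (erm P th0 (fun i => a (t i))) (a o)))) prod_weight w t
    <= (1 + #|{: 'I_K * boost_index d n l}|%:R) * expR (- (n%:R * eps ^+ 2 / 128)).
Proof.
move=> Pd Pp n0 nl w0 w1 a1 pa eps01 small.
pose Th : finType := ('I_K * boost_index d n l)%type.
pose z (t : {ffun 'I_n -> Om}) i := a (t i).
pose G1 (t : {ffun 'I_n -> Om}) o := - agreement p (a o).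
pose G2 (th : Th) (t : {ffun 'I_n -> Om}) o := corr (candidate P th (z t)) (a o).
pose bad (G : {ffun 'I_n -> Om} -> Om -> R) t :=
  n%:R * eps <= \sum_i (G t (t i) - mean w (G t)).
set e := expR _.
have bad1 : \sum_(t | bad G1 t) prod_weight w t <= e.
  apply: (concentration w0 w1 (U := finset.set0)) => //; last first.
    by rewrite cards0 mulr0 mulr_ge0 //; case/andP: eps01 => /ltW.
  by move=> t o; rewrite normrN; apply: norm_agreement_le1.
have bad2 th : \sum_(t | bad (G2 th) t) prod_weight w t <= e.
  apply: (concentration w0 w1 (U := support th.2)) => //.
  - by move=> t o; apply: norm_corr_le1.
  - by move=> t i o iU; rewrite /G2 /z candidate_upd.
  - by apply: le_trans small; rewrite ler_wpM2l // ler_nat card_support.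
apply: (@le_trans _ _ (\sum_(t | bad G1 t) prod_weight w t +
    \sum_(th : Th) \sum_(t | bad (G2 th) t) prod_weight w t)); last first.
  rewrite mulrDl mul1r lerD // mulr_natl -sumr_const; exact: ler_sum.
have -> : \sum_(th : Th) \sum_(t | bad (G2 th) t) prod_weight w t =
    \sum_t \sum_(th : Th) (if bad (G2 th) t then prod_weight w t else 0).
  by rewrite exchange_big; apply: eq_bigr => th _; rewrite big_mkcond.
rewrite big_mkcond [X in _ <= X + _]big_mkcond -big_split /=.
apply: ler_sum => t _; have W0 := prod_weight_ge0 w0 t.
have S0 : 0 <= \sum_(th : Th) (if bad (G2 th) t then prod_weight w t else 0).
  by apply: sumr_ge0 => th _; case: ifP.
case: ifPn => [fail|_]; last by rewrite addr_ge0 //; case: ifP.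
have [Wt0|Wt0] := eqVneq (prod_weight w t) 0; first by rewrite {1}Wt0 addr_ge0 //; case: ifP.
case: ifPn => [_|good1]; first by rewrite lerDl.
have [[th bth]|good2] := pselect (exists th, bad (G2 th) t).
  rewrite add0r (bigD1 th) //= bth lerDl; apply: sumr_ge0 => th' _; by case: ifP.
exfalso; move/negP: fail; apply.
(* Labels match [p] only on atoms of positive weight, so samples of probability 0 were set aside
   above. *)
have wt i : 0 < w (t i).
  rewrite lt_neqAle w0 andbT eq_sym; apply: contraNneq Wt0 => e0.
  by rewrite /prod_weight (bigD1 i) //= e0 mul0r.
have nR : (0 : R) < n%:R by rewrite ltr0n.
have sumB (G : {ffun 'I_n -> Om} -> Om -> R) : ~~ bad G t -> \sum_i G t (t i) < n%:R * (mean w (G t) + eps).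
  rewrite -ltNge sumrB sumr_const card_ord -mulr_natl; lra.
have mG1 : mean w (G1 t) = - mean w (fun o => agreement p (a o)).
  by rewrite /mean -sumrN; apply: eq_bigr => o _; rewrite mulrN.
have := sumB _ good1; rewrite mG1 sumrN => h1.
have [s cs] := compression (fun i => label (z t i)) (Pd j) Pp n0 nl.
have h2 : \sum_i agreement p (z t i) <= \sum_i corr (candidate P (j, s) (z t)) (z t i).
  apply: ler_sum => i _; apply: agreement_le_corr => b pb.
  by apply: cs => /=; rewrite pb (pa _ _ (wt i) pb).
rewrite -(ler_pM2l nR).
have h3 : \sum_i corr (candidate P (j, s) (z t)) (z t i) <=
    \sum_i corr (erm P th0 (z t)) (z t i).
  rewrite /erm; case: arg_maxP => // th _ /(_ (j, s) isT); exact.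
have h4 : \sum_i corr (erm P th0 (z t)) (z t i) <
    n%:R * (mean w (fun o => corr (erm P th0 (z t)) (a o)) + eps).
  set th := [arg max_(th > th0) \sum_i corr (candidate P th (z t)) (z t i)]%O.
  by apply: (sumB (G2 th)); apply/negP => b; apply: good2; exists th.
move: h1 h2 h3 h4; rewrite /z.
set A := \sum_i agreement _ _; set C := \sum_i corr _ _; set L := \sum_i corr _ _.
set M := mean _ _; set N := mean _ _ => *; lra.
Qed.

(** * Averaging over thresholds *)

Definition agree (X : Type) (eta1 eta2 th : R) (s b : hyp X) (x : X) : option bool :=
  match thr (fun _ => 0) eta1 s x, thr (fun _ => th) eta2 b x with
  | Some u, Some v => if u == v then Some (0 < u) else None
  | _, _ => None
  end.

Definition agree_class (X : Type) (S B : set (hyp X)) (eta1 eta2 th : R) :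
  set (X -> option bool) :=
  [set p | exists2 s, S s & exists2 b, B b & p = agree eta1 eta2 th s b].

Lemma thr_sgn (X : Type) (r : X -> R) (eta : R) (h : hyp X) (x : X) (u : R) :
  thr r eta h x = Some u -> u = sgn (0 < u).
Proof.
rewrite /thr /sgn; case: (h x) => // v.
by case: ifP => _; [|case: ifP => _ //] => -[<-]; rewrite ?ltr01 // ltr0N1.
Qed.

Lemma agreeP (X : Type) (eta1 eta2 th : R) (s b : hyp X) (x : X) (c : bool) :
  agree eta1 eta2 th s b x = Some c ->
  thr (fun _ => 0) eta1 s x = Some (sgn c) /\ thr (fun _ => th) eta2 b x = Some (sgn c).
Proof.
rewrite /agree; case Es: (thr _ eta1 s x) => [u|//]; case: (thr _ eta2 b x) => [v|//].
by case: eqP => // <- [<-]; rewrite -(thr_sgn Es).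
Qed.

Lemma agree_label (X : Type) (eta1 eta2 th : R) (s b : hyp X) (x : X) (y : R) (c : bool) :
  0 <= eta1 -> s x = Some y -> agree eta1 eta2 th s b x = Some c -> c = (0 < y).
Proof.
move=> e0 sx ac; have [+ _] := agreeP ac; clear ac; rewrite /thr sx /sgn.
case: ifP => [h|_]; last (case: ifP => // h); case: c => /Some_inj e; lra.
Qed.

(** Where [agree] is defined, both thresholded functions take its value, so whatever it shatters is
    shattered by both thresholded classes. *)
Lemma agree_class_vc (X : Type) (S B : set (hyp X)) (eta1 eta2 th m : R) (d : nat) :
  (m_VC S B eta1 eta2 <= m%:E)%E -> m < d.+1%:R ->
  vc_le (agree_class S B eta1 eta2 th) d.
Proof.
move=> Sm md k e einj sh; rewrite -ltnS -(ltr_nat R); apply: le_lt_trans md.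
rewrite -lee_fin; apply: le_trans Sm.
apply: le_trans (ereal_sup_ubound (_ : range _ (VC2 (thr_const S 0 eta1) (thr_const B th eta2)))); last by exists th.
apply: ereal_sup_ubound; exists k => //; exists e; split=> //; split=> xi.
  have [_ [s Ss [b Bb ->]] h] := sh xi.
  exists (thr (fun _ => 0) eta1 s); first by exists s.
  by move=> i; have [] := agreeP (h i).
have [_ [s Ss [b Bb ->]] h] := sh xi.
exists (thr (fun _ => th) eta2 b); first by exists b.
by move=> i; have [] := agreeP (h i).
Qed.

Lemma count_below (K : nat) (z : R) : z <= K%:R -> z <= \sum_(j < K) (j%:R < z)%R%:R.
Proof.
elim: K => [|K IH] zK; first by rewrite big_ord0.
have [zK'|zK'] := leP z K%:R.
  by rewrite big_ord_recr /= ler_wpDr // IH.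
apply: le_trans zK _; rewrite (eq_bigr (fun _ => 1)) ?sumr_const ?card_ord // => j _.
by rewrite (le_lt_trans _ zK') // ler_nat -ltnS.
Qed.

Lemma count_upto (K : nat) (z : R) : 0 <= z -> \sum_(j < K) (j%:R <= z)%R%:R <= z + 1.
Proof.
move=> z0; elim: K => [|K IH]; first by rewrite big_ord0; lra.
rewrite big_ord_recr /=; have [Kz|Kz] := leP K%:R z; last by rewrite addr0.
apply: le_trans (_ : K.+1%:R <= _); last by rewrite -natr1 lerD2r.
rewrite -natr1 lerD2r -[K in leRHS]card_ord -sumr_const; apply: ler_sum => j _.
by case: (_ <= z); rewrite ?ler01.
Qed.

Definition grid (K : nat) (j : 'I_K) : R := -1 + 2 * j%:R / K%:R.

(* u v is the average over theta in [-1,1] of u sgn(v - theta); the grid and the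
   margins eta2 each cost at most eta2. *)
Lemma gprod_le_average (X : Type) (K : nat) (eta1 eta2 y : R) (s b : hyp X) (x : X) :
  0 <= eta1 -> 2 <= K%:R * eta2 -> (0 < K)%N -> 0 < eta2 ->
  -1 <= y <= 1 -> (forall v, b x = Some v -> -1 <= v <= 1) -> s x = Some y ->
  gprod y (b x) <=
    (\sum_(j < K) agreement (agree eta1 eta2 (grid j) s b) (x, y)) / K%:R + 2 * eta1 + 2 * eta2.
Proof.
move=> e1 K2 K0 e2 y1 b1 sx; have KR : (0 : R) < K%:R by rewrite ltr0n.
suff H : (gprod y (b x) - 2 * eta1 - 2 * eta2) * K%:R <=
    \sum_(j < K) agreement (agree eta1 eta2 (grid j) s b) (x, y).
  by rewrite -ler_pdivlMr // in H; lra.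
have low (j : 'I_K) : - `|y| <= agreement (agree eta1 eta2 (grid j) s b) (x, y).
  by rewrite /agreement; case: (agree _ _ _ _ _ _) => //= _; apply: le_trans (normr_ge0 y); rewrite oppr_le0.
have sum_low : - `|y| * K%:R <= \sum_(j < K) agreement (agree eta1 eta2 (grid j) s b) (x, y).
  by rewrite -[K in leLHS]card_ord mulr_natr -sumr_const; apply: ler_sum.
case bx: (b x) => [v|]; last first.
  by apply: le_trans sum_low; rewrite ler_pM2r //=; lra.
have v1 := b1 v bx; rewrite /=.
(* For |y| <= eta1 the threshold erases [s x]; the trivial bounds y v <= |y| and - |y| differ by at
   most 2 eta1. *)
have [ysmall|ybig] := leP `|y| eta1.
  apply: le_trans sum_low; rewrite ler_pM2r //.
  have : y * v <= `|y| by apply: le_trans (ler_norm _) _; rewrite normrM ler_piMr // ler_norml.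
  lra.
have gridE (j : 'I_K) : grid j * K%:R = 2 * j%:R - K%:R.
  by rewrite /grid; field; rewrite gt_eqF.
have [y0|y0] := ltP 0 y.
  rewrite gtr0_norm // in ybig.
  (* Chosen so that [grid j + eta2 < v] exactly when j < z. *)
  pose z := K%:R * (v - eta2 + 1) / 2.
  have agr (j : 'I_K) : y * (2 * (j%:R < z)%R%:R - 1) <=
      agreement (agree eta1 eta2 (grid j) s b) (x, y).
    case: ltP => jz; last by rewrite mulr0 sub0r mulrN1 -{1}(gtr0_norm y0).
    rewrite /agreement /agree /thr /= sx bx add0r ybig.
    have -> : grid j + eta2 < v.
      by rewrite -(ltr_pM2r KR) mulrDl gridE; move: jz; rewrite /z; lra.
    by rewrite eqxx gtr0_norm //; lra.
  apply: le_trans (ler_sum _ (fun j _ => agr j)).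
  rewrite -big_distrr /= sumrB -big_distrr /= sumr_const card_ord.
  have zK : z <= K%:R by rewrite /z; nra.
  have cz := count_below zK; move: cz; set c := \sum_(j < K) _ => cz.
  apply: le_trans (_ : y * (2 * z - K%:R) <= _); last first.
    by apply: ler_wpM2l; [exact: ltW|lra].
  have -> : y * (2 * z - K%:R) = y * (v - eta2) * K%:R by rewrite /z; field.
  rewrite ler_pM2r //; nra.
rewrite ler0_norm // in ybig.
pose z := K%:R * (v + eta2 + 1) / 2.
have agr (j : 'I_K) : - y * (1 - 2 * (j%:R <= z)%R%:R) <=
    agreement (agree eta1 eta2 (grid j) s b) (x, y).
  have [jz|jz] := leP j%:R z.
    by apply: le_trans (low j); rewrite ler0_norm // mulr1; lra.
  rewrite /agreement /agree /thr /= sx bx add0r sub0r.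
  have -> : (eta1 < y) = false by apply/negbTE; rewrite -leNgt; lra.
  have h : v < grid j - eta2.
    by rewrite -(ltr_pM2r KR) mulrBl gridE; move: jz; rewrite /z; lra.
  have -> : (grid j + eta2 < v) = false by apply/negbTE; rewrite -leNgt; lra.
  have -> : y < - eta1 by lra.
  by rewrite h eqxx ler0_norm // mulr0; lra.
apply: le_trans (ler_sum _ (fun j _ => agr j)).
rewrite -big_distrr /= sumrB -big_distrr /= sumr_const card_ord.
have z0 : 0 <= z by rewrite /z; nra.
have cz := count_upto K z0; move: cz; set c := \sum_(j < K) _ => cz.
apply: le_trans (_ : - y * (K%:R - 2 * (z + 1)) <= _); last first.
  by apply: ler_wpM2l; lra.
(* The final 2 is the rounding error of the grid, absorbed by 2 <= K eta2; with the margin this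
   makes 2 eta2. *)
have -> : K%:R - 2 * (z + 1) = - v * K%:R - eta2 * K%:R - 2 by rewrite /z; field.
nra.
Qed.

(** * Sample size *)

Lemma exists_nat_ceil (K : realType) (x : K) : 0 <= x ->
  exists n, [/\ (0 < n)%N, x < n%:R & n%:R <= x + 1].
Proof.
move=> x0; exists (Num.truncn x).+1; have /andP[h1 h2] := truncn_itv x0.
by split; rewrite // -natr1 lerD2r.
Qed.

Lemma ln_le_sub1 (K : realType) (x : K) : 0 < x -> ln x <= x - 1.
Proof. by move=> x0; have := @le_ln1Dx K (x - 1); rewrite subrKC; apply; lra. Qed.

Lemma ln2_bounds (K : realType) : 0 < ln (2 : K) <= 1.
Proof. by rewrite ln_gt0 ?ltr1n //=; have := @ln_le_sub1 K 2; lra. Qed.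

Lemma ln_expn (K : realType) (n : nat) (x : K) : 0 < x -> ln (x ^+ n) = n%:R * ln x.
Proof. by move=> x0; rewrite lnXn // mulr_natl. Qed.

(** Apply ln s <= s - 1 to s = sqrt r. *)
Lemma sqr_ln_le (K : realType) (r : K) : 1 <= r -> (1 + ln r) ^+ 2 <= 4 * r.
Proof.
move=> r1; have r0 : 0 < r by lra.
have s0 : 0 < Num.sqrt r by rewrite sqrtr_gt0.
have sr : Num.sqrt r ^+ 2 = r by rewrite sqr_sqrtr // ltW.
have -> : 4 * r = (2 * Num.sqrt r) ^+ 2 by rewrite exprMn sr; ring.
have lr : ln r = 2 * ln (Num.sqrt r) by rewrite -[in LHS]sr lnXn // mulr_natl.
have := ln_le_sub1 s0; have := ln_ge0 r1 => h1 h2.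
by rewrite lerXn2r ?nnegrE //; lra.
Qed.

(* With n0 = A d L^2 / beta^2 and r = n / n0, both 1 + ln n0 <= 45 L and
   1 + ln n <= (1 + ln n0) (1 + ln r). *)
Lemma sample_size_log (K : realType) (d : nat) (A L beta n : K) :
  1 <= A -> ln A <= 40 -> (0 < d)%N -> 1 <= L -> 0 < beta <= 1 -> ln (d%:R / beta) <= L ->
  A * (d%:R * L ^+ 2) / beta ^+ 2 <= n ->
  A * (d%:R * (1 + ln n) ^+ 2) <= 90 ^+ 2 * (n * beta ^+ 2).
Proof.
move=> A1 A40 d0 L1 /andP[b0 b1] uL; set n0 := _ / _ => n0n.
have d1 : (1 : K) <= d%:R by rewrite ler1n.
have u1 : 1 <= d%:R / beta by rewrite ler_pdivlMr // mul1r; lra.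
have L2 : 1 <= L ^+ 2 by rewrite exprn_ege1.
have b2 : 0 < beta ^+ 2 by rewrite exprn_gt0.
have n01 : 1 <= n0.
  rewrite /n0 ler_pdivlMr // mul1r; apply: (@le_trans _ _ 1).
    by rewrite exprn_ile1 // ltW.
  by apply: mulr_ege1 => //; exact: mulr_ege1.
have n0E : n0 * beta ^+ 2 = A * (d%:R * L ^+ 2) by rewrite /n0 divfK // gt_eqF.
have ln0 : ln n0 <= 40 + 4 * L.
  (* Replacing d by d^2 leaves only logarithms bounded through [L]: ln n0 <= ln A + 2 ln L + 2 ln (d
     / beta). *)
  have le1 : n0 <= A * (L ^+ 2 * (d%:R / beta) ^+ 2).
    rewrite -(ler_pM2r b2) n0E.
    have -> : A * (L ^+ 2 * (d%:R / beta) ^+ 2) * beta ^+ 2 = A * (d%:R * L ^+ 2) * d%:R.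
      by field; rewrite gt_eqF.
    by rewrite ler_peMr // !mulr_ge0 //; lra.
  have p1 : 0 < L by lra.
  have p2 : 0 < d%:R / beta by lra.
  apply: (@le_trans _ _ (ln (A * (L ^+ 2 * (d%:R / beta) ^+ 2)))).
    rewrite ler_ln // posrE; first by lra.
    by apply: mulr_gt0; [lra|apply: mulr_gt0; rewrite exprn_gt0].
  have pA : 0 < A by lra.
  have pB : 0 < L ^+ 2 by rewrite exprn_gt0.
  have pC : 0 < (d%:R / beta) ^+ 2 by rewrite exprn_gt0.
  have pBC := mulr_gt0 pB pC.
  rewrite (lnM pA pBC) (lnM pB pC) !ln_expn //.
  have := ln_le_sub1 p1; lra.
pose r := n / n0.
have r1 : 1 <= r by rewrite /r ler_pdivlMr ?mul1r //; lra.
have rE : n = n0 * r by rewrite /r mulrC divfK // gt_eqF //; lra.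
have lnn : ln n = ln n0 + ln r by rewrite {1}rE lnM ?posrE //; lra.
have l0 := ln_ge0 n01; have lr := ln_ge0 r1.
have le2 : 1 + ln n <= (1 + ln n0) * (1 + ln r).
  by rewrite lnn mulrDl !mulrDr !mul1r mulr1; have := mulr_ge0 l0 lr; lra.
have le3 : (1 + ln n) ^+ 2 <= (45 * L) ^+ 2 * (4 * r).
  apply: (@le_trans _ _ (((1 + ln n0) * (1 + ln r)) ^+ 2)).
    by rewrite lerXn2r ?nnegrE ?mulr_ge0 //; lra.
  rewrite exprMn ler_pM ?sqr_ge0 ?sqr_ln_le //.
  by rewrite lerXn2r ?nnegrE; lra.
have -> : 90 ^+ 2 * (n * beta ^+ 2) = A * (d%:R * ((45 * L) ^+ 2 * (4 * r))).
  by rewrite rE (mulrAC n0) n0E; ring.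
by rewrite ler_wpM2l ?ler_wpM2l //; lra.
Qed.

(** Since e^(1/8) <= 8/7, any l > 8 ln n gives (8/7)^l > n. *)
Lemma rounds_exist (K : realType) (n : nat) : (0 < n)%N ->
  exists l, (7 ^ l * n < 8 ^ l)%N /\ l%:R <= 8 * (1 + ln (n%:R : K)).
Proof.
move=> n0; have nR : (0 : K) < n%:R by rewrite ltr0n.
have ln0 : 0 <= ln (n%:R : K) by rewrite ln_ge0 // ler1n.
have [l [_ h1 h2]] := @exists_nat_ceil K (8 * ln n%:R) (mulr_ge0 (ler0n _ _) ln0).
exists l; split; last by lra.
rewrite -(ltr_nat K) natrM !natrX.
have e8 : 7 * expR (1 / 8) <= 8 :> K.
  have := expR_ge1Dx (- (1 / 8) : K); rewrite expRN => h.
  have e0 : 0 < expR (1 / 8) :> K by exact: expR_gt0.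
  have : (1 - 1 / 8) * expR (1 / 8) <= (expR (1 / 8))^-1 * expR (1 / 8) :> K by rewrite ler_pM2r.
  by rewrite mulVf ?gt_eqF //; lra.
have p7 : 0 < 7 ^+ l :> K by rewrite exprn_gt0.
apply: (@lt_le_trans _ _ ((7 * expR (1 / 8)) ^+ l)); last first.
  by rewrite lerXn2r ?nnegrE // mulr_ge0 ?expR_ge0.
rewrite exprMn ltr_pM2l // -expRM_natl -[ltLHS]lnK ?posrE // ltr_expR.
lra.
Qed.

Lemma logp_ge1 (u : R) : 1 <= logp u.
Proof.
have /andP[l0 _] := ln2_bounds R; rewrite /logp ler_pdivlMr // mul1r.
by rewrite ler_ln ?posrE ?lt_max ?le_max ?lexx //; apply/orP; left.
Qed.

Lemma ln_le_logp (u : R) : 0 < u -> ln u <= logp u.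
Proof.
move=> u0; have /andP[l0 l1] := ln2_bounds R.
have le1 : ln u <= ln (Num.max 2 u).
  by rewrite ler_ln ?posrE ?lt_max ?u0 ?orbT // le_max lexx orbT.
apply: le_trans le1 _; rewrite /logp ler_pdivlMr // ler_piMr //.
by apply: ln_ge0; rewrite le_max; apply/orP; left; rewrite ler1n.
Qed.

Lemma card_candidates (K d n l : nat) :
  #|{: 'I_K * boost_index d n l}| = (K * ((8 * d).+1 * n ^ (8 * d)) ^ l)%N.
Proof. by rewrite card_prod card_tuple card_prod card_ffun !card_ord. Qed.

(** Uses 8d + 1 <= e^(8d); the exponential form is the one to be set against the Chernoff factor. *)
Lemma ln_card_candidates (K d n l : nat) : (0 < n)%N ->
  ((K * ((8 * d).+1 * n ^ (8 * d)) ^ l)%:R : R) <=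
    K%:R * expR (l%:R * (8 * d%:R * (1 + ln n%:R))).
Proof.
move=> n0; have nR : (0 : R) < n%:R by rewrite ltr0n.
rewrite natrM ler_wpM2l // natrX expRM_natl lerXn2r ?nnegrE ?expR_ge0 //.
rewrite mulrDr mulr1 exp.expRD natrM ler_pM //.
  by rewrite -natr1 natrM addrC; exact: expR_ge1Dx.
by rewrite -natrM expRM_natl lnK ?posrE // natrX.
Qed.

Lemma expR1_le4 : expR (1 : R) <= 4.
Proof.
have e0 : 0 < expR (1 / 2) :> R by exact: expR_gt0.
have := expR_ge1Dx (- (1 / 2) : R); rewrite expRN => h.
have : (1 - 1 / 2) * expR (1 / 2) <= (expR (1 / 2))^-1 * expR (1 / 2) :> R by rewrite ler_pM2r.
rewrite mulVf ?gt_eqF // => h2.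
rewrite (_ : expR 1 = expR (1 / 2) * expR (1 / 2) :> R); last first.
  by rewrite -exp.expRD; congr expR; field.
have h3 : expR (1 / 2) <= 2 :> R by lra.
by apply: le_trans (ler_pM _ _ h3 h3) _; rewrite ?expR_ge0 //; lra.
Qed.

(** [A] multiplies the sample size and so also enters ln n, hence the cap on its logarithm. The
    factor 64 * 128 outweighs the 90^2 of [sample_size_log], leaving 512 * 512 to beat the other
    numerical constants. *)
Lemma exists_constant : exists2 A : R, 64 * 128 * (512 * 512) <= A & ln A <= 40.
Proof.
exists (2 ^+ 40); last by rewrite ln_expn // ler_piMr //; case/andP: (ln2_bounds R).
by rewrite (_ : 64 * 128 * (512 * 512) = 2 ^+ 31 :> R) ?ler_weXn2l ?ler1n //; ring.
Qed.

(** The union bound over thresholds is paid by a power of 1 / (eta2 delta), that is, by a multiple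
    of its logarithm in the exponent. *)
Lemma grid_size_bound (eta2 delta K : R) : 0 < eta2 -> 0 < delta ->
  4 <= 1 / (eta2 * delta) -> K * eta2 <= 3 ->
  2 * K <= delta / 2 * (1 / (eta2 * delta)) ^+ 3.
Proof.
move=> e0 d0; set v := 1 / _ => v4 Ke.
have vE : v * eta2 * delta = 1 by rewrite /v; field; rewrite !gt_eqF.
have v2 : 4 * 4 <= v * v by apply: ler_pM.
have v16 : 16 * v <= v ^+ 3 by rewrite exprSr expr2; apply: ler_wpM2r; lra.
apply: (@le_trans _ _ (delta / 2 * (16 * v))); last by apply: ler_wpM2l => //; lra.
rewrite -(ler_pM2r e0).
have -> : delta / 2 * (16 * v) * eta2 = 8 * (v * eta2 * delta) by field.
by rewrite vE; lra.
Qed.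

Lemma parameters (A m eta2 beta delta : R) :
  64 * 128 * (512 * 512) <= A -> ln A <= 40 ->
  0 <= m -> 0 < eta2 < 1 / 2 -> 0 < beta < 1 / 2 -> 0 < delta < 1 / 2 ->
  exists K n l : nat,
    [/\ (0 < K)%N, 2 <= K%:R * eta2, (0 < n)%N & (7 ^ l * n < 8 ^ l)%N] /\
    [/\ 4 * (l * (8 * Num.truncn m))%:R <= n%:R * (beta / 4),
        (1 + #|{: 'I_K * boost_index (Num.truncn m) n l}|%:R) *
          expR (- (n%:R * (beta / 4) ^+ 2 / 128)) <= delta / 2 &
        n%:R <= 2 * A * (m / beta ^+ 2 * logp (m / beta) ^+ 2
             + 1 / beta ^+ 2 * ln (1 / (eta2 * delta)))].
Proof.
move=> A1 A40 m0 /andP[e0 e1] /andP[b0 b1] /andP[d0 d1]; set d := Num.truncn m.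
have dm : d%:R <= m by rewrite truncn_le.
pose P := ln (1 / (eta2 * delta)); pose L := logp (m / beta).
have L1 : 1 <= L by exact: logp_ge1.
have b2 : 0 < beta ^+ 2 by rewrite exprn_gt0.
have ed0 : 0 < eta2 * delta by rewrite mulr_gt0.
have edP : expR P = 1 / (eta2 * delta) by rewrite lnK // posrE divr_gt0.
have ed4 : 4 <= 1 / (eta2 * delta) by rewrite ler_pdivlMr //; nra.
have P1 : 1 <= P by rewrite -ler_expR edP; apply: le_trans ed4; exact: expR1_le4.
have [K [K0 K2 K3]] := exists_nat_ceil (ltW (divr_gt0 (ltr0Sn R 1) e0)).
have A0 : 0 < A by lra.
pose Q := m / beta ^+ 2 * L ^+ 2 + 1 / beta ^+ 2 * P.
have mL : 0 <= m * L ^+ 2 by rewrite mulr_ge0 ?sqr_ge0.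
have QE : Q * beta ^+ 2 = m * L ^+ 2 + P by rewrite /Q; field; rewrite gt_eqF.
have b21 : beta ^+ 2 <= 1 by rewrite expr2; nra.
have Q1 : 1 <= Q by rewrite -(ler_pM2r b2) mul1r QE; lra.
have AQ1 : 1 <= A * Q by apply: mulr_ege1 => //; lra.
(* As A Q >= 1, rounding up at most doubles it: the source of the factor 2 in the bound. *)
have [n [n0 nQ nQ']] := exists_nat_ceil (le_trans ler01 AQ1).
have [l [ln7 ln8]] := rounds_exist R n0.
exists K, n, l; split; first by split; rewrite // -ler_pdivrMr // ltW.
have nR : (0 : R) < n%:R by rewrite ltr0n.
have lnn : 0 <= ln (n%:R : R) by rewrite ln_ge0 // ler1n.
(* The Chernoff exponent is Y / 2048, while the number of votes per threshold has logarithm at most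
   64 X. *)
pose Y := n%:R * beta ^+ 2; pose X := d%:R * (1 + ln n%:R : R) ^+ 2.
have YQ : A * (m * L ^+ 2 + P) <= Y by rewrite -QE mulrA /Y ler_pM2r //; exact: ltW.
have AP : A * P <= Y by have := mulr_ge0 (ltW A0) mL; lra.
have AX : A * X <= 90 ^+ 2 * Y.
  have [d00|d00] := posnP d.
    by rewrite /X d00 mul0r mulr0 mulr_ge0 ?exprn_ge0 // /Y mulr_ge0 ?ltW.
  have d1R : (1 : R) <= d%:R by rewrite ler1n.
  rewrite /X /Y; apply: (@sample_size_log R d A L) => //; first by lra.
  - by rewrite b0 /=; lra.
  - apply: le_trans (ln_le_logp _); last by rewrite divr_gt0 //; lra.
    by rewrite ler_ln ?posrE ?divr_gt0 ?ler_pM2r ?invr_gt0 //; lra.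
  - rewrite ler_pdivrMr //; apply: le_trans YQ; rewrite ler_pM2l //.
    apply: (@le_trans _ _ (m * L ^+ 2)); last by lra.
    by rewrite ler_wpM2r ?sqr_ge0.
have X0 : 0 <= X by rewrite /X mulr_ge0 ?sqr_ge0.
have Y0 : 0 <= Y by rewrite /Y mulr_ge0 ?ltW.
have XY : 512 * 512 * X <= Y.
  by have := ler_wpM2r X0 A1; rewrite expr2 in AX; lra.
have PY : 64 * 128 * (512 * 512) * P <= Y.
  by have := ler_wpM2r (le_trans ler01 P1) A1; lra.
pose D := d%:R * (1 + ln n%:R : R).
have D0 : 0 <= D by rewrite mulr_ge0 //; lra.
have DX : D <= X by rewrite /X /D expr2 mulrA ler_peMr //; lra.
have lD : l%:R * (8 * d%:R * (1 + ln n%:R)) <= 64 * X :> R.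
  have -> : l%:R * (8 * d%:R * (1 + ln n%:R)) = l%:R * (8 * D) :> R by rewrite /D; ring.
  apply: (@le_trans _ _ (8 * (1 + ln n%:R) * (8 * D))).
    by rewrite ler_wpM2r // mulr_ge0.
  by rewrite le_eqVlt; apply/orP; left; apply/eqP; rewrite /D /X; ring.
split; last by apply: le_trans nQ' _; rewrite -/L -/P -/Q; lra.
all: clear A1 A40 A0 AQ1 nQ nQ' YQ AP AX QE Q1 mL dm.
- have Yb : Y <= n%:R * beta by rewrite /Y expr2 mulrA ler_piMr ?mulr_ge0 ?ltW //; lra.
  have ld : l%:R * d%:R <= 8 * D :> R.
    by have := ler_wpM2l (ler0n R d) ln8; rewrite /D; lra.
  rewrite !natrM; lra.
- have N := ln_card_candidates K d l n0; rewrite -card_candidates in N.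
  set c := (#|_|%:R : R) in N *; set E := l%:R * _ in N lD.
  have K1 : (1 : R) <= K%:R by rewrite ler1n.
  have E1 : 1 <= expR E.
    by rewrite -exp.expR0 ler_expR /E !mulr_ge0 //; lra.
  have KE : 1 <= K%:R * expR E by exact: mulr_ege1.
  have Ke : K%:R * eta2 <= 3.
    have := ler_wpM2r (ltW e0) K3; rewrite mulrDl divfK ?gt_eqF // mul1r; lra.
  have K3P : 2 * K%:R <= delta / 2 * expR (3 * P).
    by rewrite expRM_natl edP; exact: grid_size_bound.
  have -> : - (n%:R * (beta / 4) ^+ 2 / 128) = - (Y / 2048) :> R by rewrite /Y; field.
  apply: (@le_trans _ _ (2 * K%:R * expR E * expR (- (Y / 2048)))).
    by rewrite ler_wpM2r ?expR_ge0 //; lra.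
  apply: (@le_trans _ _ (delta / 2 * expR (3 * P) * expR E * expR (- (Y / 2048)))).
    by rewrite !ler_wpM2r ?expR_ge0.
  have le1 : expR (3 * P) * expR E * expR (- (Y / 2048)) <= 1.
    by rewrite -!exp.expRD -[leRHS]exp.expR0 ler_expR; lra.
  have d2 : 0 <= delta / 2 by lra.
  by have := ler_wpM2l d2 le1; rewrite !mulrA mulr1.
Qed.

(** * The learner *)

Lemma norm_gprod_le1 (X : Type) (B : set (hyp X)) (b : hyp X) (p : X * R) :
  valid_class B -> B b -> -1 <= p.2 <= 1 -> `|gprod p.2 (b p.1)| <= 1.
Proof.
move=> VB Bb p1; have p1' : `|p.2| <= 1 by rewrite ler_norml.
rewrite /gprod; case bx: (b p.1) => [v|]; last by rewrite normrN normr_id.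
by rewrite normrM mulr_ile1 // ler_norml; exact: VB Bb _ _ bx.
Qed.

(** Concentration is available for a single comparator fixed before sampling; a near-maximiser then
    answers for every [b]. *)
Lemma near_optimal (X : Type) (B : set (hyp X)) (w : nat -> R) (a : nat -> X * R) (e : R) :
  valid_class B -> Defs.distribution w a -> 0 < e -> B !=set0 ->
  exists2 b0, B b0 & forall b, B b ->
    expect w a (fun p => gprod p.2 (b p.1)) - e <= expect w a (fun p => gprod p.2 (b0 p.1)).
Proof.
move=> VB Dwa e0 [b1 Bb1].
pose E := [set expect w a (fun p => gprod p.2 (b p.1)) | b in B].
have ubE : has_ubound E.
  exists 1 => _ [b Bb <-].
  have a1 k : `|gprod (a k).2 (b (a k).1)| <= 1.
    by apply: norm_gprod_le1 VB Bb _; case: Dwa => _ [].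
  have := expect_tail Dwa (g := fun p => gprod p.2 (b p.1)) 0 a1.
  by rewrite /series /= !big_geq // !subr0 ler_norml => /andP[].
have [|_ [b0 Bb0 <-] h0] := @sup_adherent _ E e e0.
  by split=> //; exists (expect w a (fun p => gprod p.2 (b1 p.1))); exists b1.
exists b0 => // b Bb; apply: ltW; apply: le_lt_trans h0; rewrite lerD2r.
by apply: ub_le_sup => //; exists b.
Qed.

Lemma exists_ge_average (K : nat) (F : 'I_K -> R) (c : R) : (0 < K)%N ->
  c <= (\sum_j F j) / K%:R -> exists j, c <= F j.
Proof.
move=> K0; rewrite ler_pdivlMr ?ltr0n // => h.
have [//|H] := pselect (exists j, c <= F j).
exfalso; move: h; rewrite leNgt => /negP; apply.
have -> : c * K%:R = \sum_(j < K) c by rewrite sumr_const card_ord mulr_natr.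
apply: ltr_sum => [|j _]; last by rewrite ltNge; apply/negP => h; apply: H; exists j.
by apply/hasP; exists (Ordinal K0); rewrite ?mem_index_enum.
Qed.

Lemma learner_exists (X : Type) (S B : set (hyp X)) (A eta1 eta2 beta delta m : R) :
  64 * 128 * (512 * 512) <= A -> ln A <= 40 -> valid_class S -> valid_class B -> 0 <= eta1 -> 0 < eta2 < 1 / 2 ->
  0 < beta < 1 / 2 -> 0 < delta < 1 / 2 -> 0 <= m ->
  (m_VC S B eta1 eta2 <= m%:E)%E ->
  DCorM_num_le S B (beta + 2 * eta1 + 2 * eta2) delta
    (2 * A * (m / beta ^+ 2 * logp (m / beta) ^+ 2
             + 1 / beta ^+ 2 * ln (1 / (eta2 * delta)))).
Proof.
move=> A1 A40 VS VB e10 e2b bb db m0 mle.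
have [K [n [l [[K0 K2 n0 nl] [small tail nN]]]]] := parameters A1 A40 m0 e2b bb db.
move: e2b bb db => /andP[e20 _] /andP[b0 b1] /andP[d0 d1].
set d := Num.truncn m in small tail.
pose P (j : 'I_K) := agree_class S B eta1 eta2 (grid j).
have Pd j : vc_le (P j) d.
  by apply: agree_class_vc mle _; have /andP[] := truncn_itv m0.
pose th0 : 'I_K * boost_index d n l :=
  (Ordinal K0, nseq_tuple l (ord0, [ffun=> Ordinal n0])).
exists n; split=> //; exists (erm P th0) => w a Dwa [s Ss sa].
have [w0 [a1 cvw]] := Dwa.
(* Error budget: 2 (beta / 4) from maximisation, beta / 8 from near-optimality and beta / 16 from
   each of two truncated expectations, in all below [beta]. For the confidence, (1 - delta / 2)^2 >=
   1 - delta. *)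
have t0 : 0 < beta / 32 by lra.
have dl0 : 0 < delta / 2 by lra.
have [N [N1 Nn Npos]] := @exists_large_partial_sum _ w n _ _ cvw t0 dl0.
set SN := series w N in N1 Nn Npos.
set good := fun smp : 'I_n -> X * R => _.
have [bn|B0] := pselect (B !=set0); last first.
  have h : \sum_(t : {ffun 'I_n -> 'I_N} | ~~ `[< good (fun i => a (t i)) >])
      prod_weight (@trunc_weight w N) t <= 0.
    rewrite big1 // => t /negP; case; apply/asboolP => b Bb.
    by exfalso; apply: B0; exists b.
  apply: (le_trans _ (prob_sample_trunc Npos h)); rewrite lee_fin -/SN; lra.
have [|b' Bb' opt] := @near_optimal X B w a (beta / 8) VB Dwa _ bn; first by lra.
suff bad : \sum_(t : {ffun 'I_n -> 'I_N} | ~~ `[< good (fun i => a (t i)) >])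
    prod_weight (@trunc_weight w N) t <= delta / 2.
  apply: (le_trans _ (prob_sample_trunc Npos bad)); rewrite lee_fin -/SN.
  have d2 : 0 <= 1 - delta / 2 by lra.
  have := ler_wpM2r d2 Nn; have := mulr_ge0 (ltW dl0) (ltW dl0); lra.
pose wN := @trunc_weight w N.
have wN0 : forall o, 0 <= wN o by exact: trunc_weight_ge0.
have wN1 : \sum_o wN o = 1 by exact: sum_trunc_weight.
pose aN (o : 'I_N) := a o.
have sN o : 0 < wN o -> s (aN o).1 = Some (aN o).2.
  by move=> wo; apply: sa; rewrite -(pmulr_lgt0 _ (_ : 0 < SN^-1)) // invr_gt0.
pose g p := gprod p.2 (b' p.1).
pose agr (j : 'I_K) := agreement (X := X) (agree eta1 eta2 (grid j) s b').
have conv (h : X * R -> R) : (forall k, `|h (a k)| <= 1) ->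
    `|expect w a h - mean wN (fun o => h (aN o))| <= beta / 16.
  by move=> h1; apply: le_trans (expect_mean Dwa Npos h1) _; rewrite -/SN; lra.
(* Averaging over atoms and thresholds commutes, so one threshold is good for the whole
   distribution. It depends on the unknown distribution, which is why the learner searches all of
   them. *)
have [j Hj] : exists j, mean wN (fun o => g (aN o)) - 2 * eta1 - 2 * eta2 <=
    mean wN (fun o => agr j (aN o)).
  apply: exists_ge_average => //.
  have -> : (\sum_j mean wN (fun o => agr j (aN o))) / K%:R =
      mean wN (fun o => (\sum_j agr j (aN o)) / K%:R).
    rewrite /mean exchange_big mulr_suml; apply: eq_bigr => o _.
    by rewrite -mulr_sumr mulrA.
  rewrite -(mean_cst wN1 (2 * eta1)) -(mean_cst wN1 (2 * eta2)) /mean -!sumrB.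
  apply: ler_sum => o _; rewrite -!mulrBr.
  have := wN0 o; rewrite le_eqVlt => /orP[/eqP<-|wo]; first by rewrite !mul0r.
  rewrite ler_pM2l // /g /agr.
  have := @gprod_le_average X K eta1 eta2 (aN o).2 s b' (aN o).1 e10 K2 K0 e20 (a1 o) _ (sN o wo).
  by rewrite -surjective_pairing => /(_ (VB _ Bb' _)); lra.
have Pj : P j (agree eta1 eta2 (grid j) s b') by exists s => //; exists b'.
have lab o c : 0 < wN o -> agree eta1 eta2 (grid j) s b' (aN o).1 = Some c -> c = (0 < (aN o).2).
  by move=> wo; apply: agree_label => //; exact: sN.
have b4 : 0 < beta / 4 <= 1 by apply/andP; split; lra.
have := erm_generalizes th0 Pd Pj n0 nl wN0 wN1 (fun o => a1 o) lab b4 small.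
move=> /le_trans/(_ tail); apply: le_trans.
rewrite big_mkcond [leRHS]big_mkcond; apply: ler_sum => t _.
have W0 := prod_weight_ge0 wN0 t.
case: ifPn => [ng|_]; last by case: ifP.
case: ifPn => // /negPn ok; exfalso; move/negP: ng; apply; apply/asboolP => b Bb.
set f := erm P th0 _ in ok *.
have c1 := conv (corr f) (fun k => norm_corr_le1 f (a1 k)).
have c2 := conv g (fun k => norm_gprod_le1 VB Bb' (a1 k)).
have := opt b Bb; rewrite -/g.
move: c1 c2 ok Hj; rewrite -/(corr f) !ler_distl => /andP[h1 _] /andP[_ h2] h3 h4 h5.
rewrite -/(agr j) in h3.
change (expect w a (fun p => gprod p.2 (b p.1)) - (beta + 2 * eta1 + 2 * eta2) <=
  expect w a (corr f)).
lra.
Qed.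

(** If [S] or [B] is empty, not even the empty set is shattered by both and the supremum is -oo;
    [fine] then returns 0, still an upper bound. *)
Lemma fine_m_VC (X : Type) (S B : set (hyp X)) (eta1 eta2 : R) :
  (m_VC S B eta1 eta2 < +oo)%E ->
  0 <= fine (m_VC S B eta1 eta2) /\
  (m_VC S B eta1 eta2 <= (fine (m_VC S B eta1 eta2))%:E)%E.
Proof.
case mE: (m_VC S B eta1 eta2) => [r| |] //= _; last by split; rewrite // leNye.
split=> //; rewrite leNgt; apply/negP => r0.
suff : (m_VC S B eta1 eta2 <= -oo)%E by rewrite mE.
apply: ge_ereal_sup => _ [th _ <-]; apply: ge_ereal_sup => _ [k Hk <-].
have : ((k%:R : R)%:E <= m_VC S B eta1 eta2)%E.
  apply: le_ereal_sup_tmp; exists (VC2 (thr_const S 0 eta1) (thr_const B th eta2)); first by exists th.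
  by apply: ereal_sup_ubound; exists k.
by rewrite mE lee_fin leNgt (lt_le_trans r0).
Qed.

(** The constant [theta] is itself a fat-shattering witness, as [thr] demands a strict margin. *)
Lemma thr_shatters_fat (X : Type) (H : set (hyp X)) (theta eta : R) (k : nat) (e : 'I_k -> X) :
  shatters (thr_const H theta eta) e -> fat_shatters H eta e.
Proof.
move=> sh; exists (fun _ => theta) => xi; have [_ [h Hh <-] he] := sh xi.
exists h => // i; have := he i; rewrite /thr; case: (h (e i)) => // v.
case: ifP => [hv|_]; last (case: ifP => // hv); move=> /Some_inj E; exists v; split=> //.
  by rewrite -E mul1r; lra.
by rewrite -E mulN1r; lra.
Qed.

Lemma m_VC_le_fat (X : Type) (S B : set (hyp X)) (eta : R) :
  (m_VC S B eta eta <= fat2 eta S B)%E.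
Proof.
apply: ge_ereal_sup => _ [th _ <-]; apply: ge_ereal_sup => _ [k [e [einj [sS sB]]] <-].
apply: ereal_sup_ubound; exists k => //; exists e; split=> //.
by split; apply: thr_shatters_fat; [exact: sS|exact: sB].
Qed.

Lemma logp_mul5 (u : R) : logp (5 * u) <= 4 * logp u.
Proof.
have /andP[l0 l1] := ln2_bounds R; have L1 := logp_ge1 u.
have p2 : 0 < Num.max 2 u by rewrite lt_max ltr0n.
have p5 : (0 : R) < 5 by rewrite ltr0n.
have le5 : ln (5 : R) <= 3 * ln 2.
  by rewrite -(ln_expn 3) // ler_ln ?posrE ?exprn_gt0 //; rewrite !exprS expr0; lra.
have lnE : logp u * ln 2 = ln (Num.max 2 u) by rewrite /logp divfK ?gt_eqF.
rewrite {1}/logp ler_pdivrMr //.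
apply: (@le_trans _ _ (ln (5 * Num.max 2 u))).
  rewrite ler_ln ?posrE ?mulr_gt0 //; last by rewrite lt_max ltr0n.
  by rewrite ge_max; have : 2 <= Num.max 2 u /\ u <= Num.max 2 u;
    [rewrite !le_max !lexx orbT|move=> [h1 h2]; apply/andP; split; lra].
rewrite lnM ?posrE // -lnE.
have := ler_wpM2r (ltW l0) L1; lra.
Qed.

(** 400 = 25 * 16: the factor 25 comes from (eps / 5)^2 and 16 from the square of [logp_mul5]; the
    confidence term grows by at most 25 * 3. *)
Lemma rate_rescale (m eps delta : R) : 0 <= m -> 0 < eps < 1 / 2 -> 0 < delta < 1 / 2 ->
  m / (eps / 5) ^+ 2 * logp (m / (eps / 5)) ^+ 2 + 1 / (eps / 5) ^+ 2 * ln (1 / (eps / 5 * delta))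
  <= 400 * (m / eps ^+ 2 * logp (m / eps) ^+ 2 + 1 / eps ^+ 2 * ln (1 / (eps * delta))).
Proof.
move=> m0 /andP[e0 e1] /andP[d0 d1].
have e2 : 0 < eps ^+ 2 by rewrite exprn_gt0.
have ed0 : 0 < eps * delta by rewrite mulr_gt0.
have eN : eps != 0 by rewrite gt_eqF.
have dN : delta != 0 by rewrite gt_eqF.
set v := 1 / (eps * delta).
have v4 : 4 <= v by rewrite ler_pdivlMr //; nra.
have v0 : 0 < v by lra.
have lv : 0 <= ln v by rewrite ln_ge0 //; lra.
have -> : m / (eps / 5) = 5 * (m / eps) by field.
have -> : 1 / (eps / 5 * delta) = 5 * v by rewrite /v; field; rewrite ?eN ?dN.
have -> : m / (eps / 5) ^+ 2 = 25 * (m / eps ^+ 2) by field.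
have -> : 1 / (eps / 5) ^+ 2 = 25 * (1 / eps ^+ 2) by field.
have h1 : logp (5 * (m / eps)) ^+ 2 <= 16 * logp (m / eps) ^+ 2.
  have L1 := logp_ge1 (m / eps); have L5 := logp_ge1 (5 * (m / eps)).
  have -> : 16 * logp (m / eps) ^+ 2 = (4 * logp (m / eps)) ^+ 2 by ring.
  by rewrite lerXn2r ?nnegrE ?logp_mul5 //; lra.
have h2 : ln (5 * v) <= 3 * ln v.
  have p5 : 0 < 5 * v by lra.
  have p3 : 0 < v ^+ 3 by rewrite exprn_gt0.
  have v44 : 4 * 4 <= v * v by apply: ler_pM => //; lra.
  rewrite -(ln_expn 3 v0) ler_ln // exprSr expr2.
  by apply: ler_wpM2r; [exact: ltW|lra].
have me : 0 <= m / eps ^+ 2 by rewrite divr_ge0 // ltW.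
have ie : 0 <= 1 / eps ^+ 2 by rewrite divr_ge0 // ltW.
have := ler_wpM2l me h1; have := ler_wpM2l ie h2; have := mulr_ge0 ie lv; lra.
Qed.

Lemma DCorM_num_le_trans (X : Type) (S B : set (hyp X)) (eps delta N N' : R) :
  N <= N' -> DCorM_num_le S B eps delta N -> DCorM_num_le S B eps delta N'.
Proof. by move=> NN' [n [nN H]]; exists n; split=> //; exact: le_trans NN'. Qed.

Theorem theorem4p12 :
  exists C : R, 0 < C /\
  forall (X : Type), inhabited X ->
  forall (S B : set (hyp X)), valid_class S -> valid_class B ->
  (forall (eta1 eta2 beta delta : R),
     0 <= eta1 -> 0 < eta2 < 1/2 -> 0 < beta < 1/2 -> 0 < delta < 1/2 ->
     (m_VC S B eta1 eta2 < +oo)%E ->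
     let m := fine (m_VC S B eta1 eta2) in
     DCorM_num_le S B (beta + 2 * eta1 + 2 * eta2) delta
       (C * (m / beta ^+ 2 * logp (m / beta) ^+ 2
             + 1 / beta ^+ 2 * ln (1 / (eta2 * delta))))) /\
  (forall (eps delta : R),
     0 < eps < 1/2 -> 0 < delta < 1/2 ->
     (m_VC S B (eps / 5)%R (eps / 5)%R <= fat2 (eps / 5)%R S B)%E /\
     ((m_VC S B (eps / 5)%R (eps / 5)%R < +oo)%E ->
      let m := fine (m_VC S B (eps / 5) (eps / 5)) in
      DCorM_num_le S B eps delta
        (C * (m / eps ^+ 2 * logp (m / eps) ^+ 2
              + 1 / eps ^+ 2 * ln (1 / (eps * delta)))))).
Proof.
have [A A1 A40] := exists_constant; have A0 : 0 < 2 * A by lra.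
(* One constant for both bounds: 2 A is that of [learner_exists], and 400 pays for setting all three
   parameters to eps / 5. *)
exists (2 * A * 400); split; first by rewrite mulr_gt0.
move=> X _ S B VS VB; split=> [eta1 eta2 beta delta e10 e2b bb db mfin m|eps delta eb db].
  have [m0 mle] := fine_m_VC mfin.
  apply: DCorM_num_le_trans (learner_exists A1 A40 VS VB e10 e2b bb db m0 mle).
  rewrite -(mulrA (2 * A) 400) ler_pM2l // -/m ler_peMl ?ler1n //.
  move: e2b bb db => /andP[e20 e21] /andP[b0 _] /andP[d0 d1].
  apply: addr_ge0; first by rewrite mulr_ge0 ?sqr_ge0 // divr_ge0 ?sqr_ge0.
  rewrite mulr_ge0 ?divr_ge0 ?sqr_ge0 // ln_ge0 // ler_pdivlMr ?mulr_gt0 // mul1r.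
  by rewrite mulr_ile1 ?ltW //; lra.
split; first exact: m_VC_le_fat.
move=> mfin m; have [m0 mle] := fine_m_VC mfin.
have [e0 e1] := andP eb.
have e5 : 0 < eps / 5 < 1 / 2 by apply/andP; split; lra.
have e50 : 0 <= eps / 5 by lra.
have := learner_exists A1 A40 VS VB e50 e5 e5 db m0 mle.
have -> : eps / 5 + 2 * (eps / 5) + 2 * (eps / 5) = eps by field.
by apply: DCorM_num_le_trans; rewrite -(mulrA (2 * A) 400) ler_pM2l //; exact: rate_rescale.
Qed.
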